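(* (Open mapping theorem) Let $A\in\{\mathbb{C},\mathbb{H},\mathbb{O}\}$, let $\Omega\subseteq A$ be a circular open set and let $f\in\mathcal{SR}(\Omega)$. - If $\Omega$ is a slice domain and $f$ is not constant, then $f_{|\Omega\setminus\overline{V(f'_s)}}$ is an open map. Moreover, the image through $f$ of any circular open subset $U\subseteq\Omega$ is open. In particular, $f(\Omega)$ is open. - If the fibers $f^{-1}(y_0)$ are discrete for all $y_0\in f(\Omega)$, then $f$ is an open map.
   Context: $A$ is one of the real $*$-algebras $\mathbb{C},\mathbb{H},\mathbb{O}$ (complex numbers, quaternions, octonions) with standard conjugation $x\mapsto x^c$ and Euclidean topology; $\operatorname{im}(x)=(x-x^c)/2$; $\mathbb{S}=\{w\in A: w^2=-1\}$. For nonempty $D\subseteq\mathbb{C}$ invariant under complex conjugation, $\Omega_D=\{\alpha+\beta J:\alpha,\beta\in\mathbb{R},\,J\in\mathbb{S},\,\alpha+i\beta\in D\}$; sets of this form are called circular. If $D$ is open, connected and intersects $\mathbb{R}$, $\Omega_D$ is a slice domain. For $D$ open and $\Omega=\Omega_D$, $\mathcal{SR}(\Omega)$ is the set of slice regular functions: functions $f:\Omega\to A$ for which there are $C^1$ functions $F_1,F_2:D\to A$ with $F_1(\bar z)=F_1(z)$, $F_2(\bar z)=-F_2(z)$, $f(\alpha+\beta J)=F_1(\alpha+i\beta)+JF_2(\alpha+i\beta)$ for all $\alpha+i\beta\in D$, $J\in\mathbb{S}$, and $\partial F_1/\partial\alpha=\partial F_2/\partial\beta$, $\partial F_1/\partial\beta=-\partial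 F_2/\partial\alpha$. The spherical derivative $f'_s:\Omega\setminus\mathbb{R}\to A$ is $f'_s(x)=\frac12\operatorname{im}(x)^{-1}(f(x)-f(x^c))$, with zero set $V(f'_s)\subseteq\Omega\setminus\mathbb{R}$; $\overline{V(f'_s)}$ is its closure. Open maps and open images are with respect to the topology of $A$. *)

(* Defs.v *)
From HB Require Import structures.
From mathcomp Require Import all_boot all_order all_algebra.
From mathcomp Require Import all_classical all_reals all_analysis.
From mathcomp Require Import ring lra.
Set Implicit Arguments.
Unset Strict Implicit.
Unset Printing Implicit Defensive.
Import Order.TTheory GRing.Theory Num.Theory.
Import numFieldNormedType.Exports.
Local Open Scope classical_set_scope.
Local Open Scope ring_scope.

(* The n-th Cayley-Dickson algebra over R.  As a normed R-module it is R^(2^n)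
   with the sup norm, so its topology is the Euclidean (product) one.  There is
   no ring structure in the hierarchy, octonions being non-associative; and
   R[i] is not used for n = 1 because its normed module structure in the
   library is over R[i] rather than over R. *)
Fixpoint cd (R : realType) (n : nat) : normedModType R :=
  if n is m.+1 then (cd R m * cd R m)%type else R^o.

Fixpoint cdconj (R : realType) (n : nat) : cd R n -> cd R n :=
  match n with
  | 0 => fun x : R^o => x
  | m.+1 => fun x : cd R m * cd R m => (cdconj x.1, - x.2)
  end.

Fixpoint cdmul (R : realType) (n : nat) : cd R n -> cd R n -> cd R n :=
  match n with
  | 0 => fun x y : R^o => x * y
  | m.+1 => fun x y : cd R m * cd R m =>
      (cdmul x.1 y.1 - cdmul (cdconj y.2) x.2,
       cdmul y.2 x.1 + cdmul x.2 (cdconj y.1))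
  end.

Fixpoint cd1 (R : realType) (n : nat) : cd R n :=
  match n with
  | 0 => (1 : R^o)
  | m.+1 => (cd1 R m, 0)
  end.

(* The squared Euclidean norm; x x^c = cdsqn x, see [cdmul_conj]. *)
Fixpoint cdsqn (R : realType) (n : nat) : cd R n -> R :=
  match n with
  | 0 => fun x : R^o => x ^+ 2
  | m.+1 => fun x : cd R m * cd R m => cdsqn x.1 + cdsqn x.2
  end.

Definition cdinv (R : realType) (n : nat) (x : cd R n) : cd R n :=
  (cdsqn x)^-1 *: cdconj x.

Variant algebra_kind := Complexes | Quaternions | Octonions.

Definition doublings (A : algebra_kind) : nat :=
  match A with
  | Complexes => 1
  | Quaternions => 2
  | Octonions => 3
  end.

Definition alg (R : realType) (A : algebra_kind) : normedModType R :=
  cd R (doublings A).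

Lemma cdmul_complex (R : realType) (a b c d : R) :
  cdmul ((a, b) : cd R 1) (c, d) = (a * c - b * d, a * d + b * c).
Proof. by rewrite /= [d * b]mulrC [d * a]mulrC. Qed.

Lemma cdmul_conj (R : realType) (A : algebra_kind) (x : alg R A) :
  cdmul x (cdconj x) = cdsqn x *: cd1 R (doublings A).
Proof.
case: A x => /=.
- case=> a b; congr (_, _); rewrite /GRing.scale /=; ring.
- case=> [[a b] [c d]]; congr (_, _); congr (_, _); rewrite /GRing.scale /=; ring.
- case=> [[[a b] [c d]] [[e f] [g h]]].
  by congr (_, _); congr (_, _); congr (_, _); rewrite /GRing.scale /=; ring.
Qed.

Lemma cdsqnM (R : realType) (A : algebra_kind) (x y : alg R A) :
  cdsqn (cdmul x y) = cdsqn x * cdsqn y.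
Proof.
case: A x y => /=.
- case=> a b [a' b'] /=; ring.
- case=> [[a b] [c d]] [[a' b'] [c' d']] /=; ring.
- case=> [[[a b] [c d]] [[e f] [g h]]] [[[a' b'] [c' d']] [[e' f'] [g' h']]] /=.
  by ring.
Qed.

Definition im (R : realType) (n : nat) (x : cd R n) : cd R n :=
  2^-1 *: (x - cdconj x).

Definition is_real (R : realType) (n : nat) (x : cd R n) : Prop :=
  exists r : R, x = r *: cd1 R n.

Definition imag_units (R : realType) (n : nat) : set (cd R n) :=
  [set J | cdmul J J = - cd1 R n].

(* In what follows the complex plane containing D is [cd R 1], with
   a + i b = (a, b). *)
Definition slice_pt (R : realType) (n : nat) (z : cd R 1) (J : cd R n) : cd R n :=
  z.1 *: cd1 R n + z.2 *: J.

Definition conj_invariant (R : realType) (D : set (cd R 1)) : Prop :=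
  forall z, D z -> D (cdconj z).

Definition circularization (R : realType) (n : nat) (D : set (cd R 1)) :
    set (cd R n) :=
  [set x | exists z J, [/\ D z, imag_units J & x = slice_pt z J]].

Definition circular_over (R : realType) (n : nat) (D : set (cd R 1))
    (Omega : set (cd R n)) : Prop :=
  [/\ D !=set0, conj_invariant D & Omega = @circularization R n D].

Definition circular (R : realType) (n : nat) (Omega : set (cd R n)) : Prop :=
  exists D, circular_over D Omega.

Definition slice_domain (R : realType) (n : nat) (Omega : set (cd R n)) : Prop :=
  exists D : set (cd R 1),
    [/\ circular_over D Omega, open D, connected D & exists a : R, D (a, 0)].

Definition dalpha (R : realType) (n : nat) (F : cd R 1 -> cd R n) (z : cd R 1) :
    cd R n :=
  'D_((1, 0) : cd R 1) F z.

Definition dbeta (R : realType) (n : nat) (F : cd R 1 -> cd R n) (z : cd R 1) :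
    cd R n :=
  'D_((0, 1) : cd R 1) F z.

(* Functions on a subset are represented by total functions whose values
   outside the subset are irrelevant; D is meant to be open. *)
Definition C1_on (R : realType) (n : nat) (D : set (cd R 1))
    (F : cd R 1 -> cd R n) : Prop :=
  [/\ forall z, D z -> derivable F z ((1, 0) : cd R 1),
      forall z, D z -> derivable F z ((0, 1) : cd R 1),
      {within D, continuous (dalpha F)} &
      {within D, continuous (dbeta F)}].

Definition slice_regular (R : realType) (n : nat) (Omega : set (cd R n))
    (f : cd R n -> cd R n) : Prop :=
  exists D : set (cd R 1), [/\ open D, circular_over D Omega &
    exists F1 F2 : cd R 1 -> cd R n,
      [/\ C1_on D F1 /\ C1_on D F2,
          forall z, D z -> F1 (cdconj z) = F1 z,
          forall z, D z -> F2 (cdconj z) = - F2 z,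
          forall z J, D z -> imag_units J ->
            f (slice_pt z J) = F1 z + cdmul J (F2 z) &
          forall z, D z ->
            dalpha F1 z = dbeta F2 z /\ dbeta F1 z = - dalpha F2 z]].

Definition spherical_derivative (R : realType) (n : nat)
    (f : cd R n -> cd R n) (x : cd R n) : cd R n :=
  2^-1 *: cdmul (cdinv (im x)) (f x - f (cdconj x)).

Definition sph_zeros (R : realType) (n : nat) (Omega : set (cd R n))
    (f : cd R n -> cd R n) : set (cd R n) :=
  [set x | [/\ Omega x, ~ is_real x & spherical_derivative f x = 0]].

Definition constant_on (T U : Type) (X : set T) (f : T -> U) : Prop :=
  exists c, forall x, X x -> f x = c.

(* The restriction of f to X, with the subspace topology on X, is open. *)
Definition open_map_on (T U : topologicalType) (X : set T) (f : T -> U) : Prop :=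
  forall V : set T, open V -> open (f @` (X `&` V)).

Definition discrete_set (T : topologicalType) (X : set T) : Prop :=
  X `<=` isolated X.

(* Main.v *)
(* Write f (alpha + beta J) = F1 + J F2.  For y in A put
   phi_y = sum_k (F1_k - y_k + i F2_k)^2, the sum running over the real
   coordinates of A; this is a complex valued holomorphic function on D, equal to
   |F1 - y|^2 - |F2|^2 + 2 i <F1 - y, F2>.  It vanishes at z exactly when f takes
   the value y on the sphere over z: if F2 z <> 0, the only candidate is
   J = - (F1 z - y) F2(z)^-1, and phi_y z = 0 says that J is an imaginary unit.
   Since J depends continuously on (y, z), openness of f reduces to Hurwitz's
   theorem for the family phi_y, provided that phi_y0 does not vanish identically
   near z0.  On a slice domain, the identity theorem turns such a vanishing into
   F1 = y0 on the real axis, hence into f = y0; if the fibers are discrete, it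
   would produce points of a fiber accumulating at one of them.  For A = C,
   Hurwitz's theorem is applied to F1 + i F2 itself.

   The complex analysis rests on Cauchy's formula on a circle, obtained by
   differentiating the integral of f (c + w + t (r e^(ix) - w)) against
   r e^(ix) / (r e^(ix) - w) with respect to t.  The algebra is done in R[i], and
   limits, derivatives and integrals are taken on real and imaginary parts. *)
Require Import Defs.
From mathcomp Require Import all_boot all_order all_algebra.
From mathcomp Require Import all_classical all_reals all_analysis.
From mathcomp Require Import ring lra.
From mathcomp Require Import complex.
Set Implicit Arguments.
Unset Strict Implicit.
Unset Printing Implicit Defensive.
Import Order.TTheory GRing.Theory Num.Theory.
Import numFieldNormedType.Exports.
Import Normc.
Local Open Scope classical_set_scope.
Local Open Scope ring_scope.
Local Open Scope complex_scope.
Local Notation Re := complex.Re.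
Local Notation Im := complex.Im.

(** * C^1 functions of two real variables *)

Section C1.
Variable R : realType.
Implicit Types (u : cd R 1 -> R) (z : cd R 1).

Lemma is_derive_line1 u (s y d : R) :
  is_derive ((s, y) : cd R 1) ((1, 0) : cd R 1) (u : cd R 1 -> R^o) (d : R^o) ->
  is_derive s (1:R) (fun s => u (s, y)) d.
Proof.
move=> [h1 h2].
have E : (fun h : R =>
      h^-1 *: ((u \o shift ((s, y) : cd R 1)) (h *: ((1, 0) : cd R 1)) - u (s, y))) =
    (fun h : R => h^-1 *: (((fun s => u (s, y)) \o shift s) (h *: (1:R)) - u (s, y))).
  apply/funext => h /=; congr (_ *: (u _ - _)).
  by rewrite /shift /=; congr (_, _); rewrite /= scaler0 add0r.
by split; [move: h1; rewrite /derivable E | move: h2; rewrite /derive E].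
Qed.

Lemma is_derive_line2 u (s y d : R) :
  is_derive ((s, y) : cd R 1) ((0, 1) : cd R 1) (u : cd R 1 -> R^o) (d : R^o) ->
  is_derive y (1:R) (fun y => u (s, y)) d.
Proof.
move=> [h1 h2].
have E : (fun h : R =>
      h^-1 *: ((u \o shift ((s, y) : cd R 1)) (h *: ((0, 1) : cd R 1)) - u (s, y))) =
    (fun h : R => h^-1 *: (((fun y => u (s, y)) \o shift y) (h *: (1:R)) - u (s, y))).
  apply/funext => h /=; congr (_ *: (u _ - _)).
  by rewrite /shift /=; congr (_, _); rewrite /= scaler0 add0r.
by split; [move: h1; rewrite /derivable E | move: h2; rewrite /derive E].
Qed.

(** The hypothesis is put on the ball around [x] of radius [|y - x|], which contains the segment
    whichever endpoint is the larger. *)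
Lemma mvt_unordered (g dg : R -> R) (x y : R) :
  (forall t, `|t - x| <= `|y - x| -> is_derive t (1:R) g (dg t)) ->
  exists2 t, `|t - x| <= `|y - x| & g y - g x = dg t * (y - x).
Proof.
move=> gd.
have cg t : `|t - x| <= `|y - x| -> {for t, continuous g}.
  move=> /gd [h _]; exact/differentiable_continuous/derivable1_diffP.
have [xy|yx] := leP x y.
  have B t : t \in `[x, y]%R -> `|t - x| <= `|y - x|.
    by rewrite in_itv /= => /andP[? ?]; rewrite !ger0_norm ?subr_ge0 // lerD2r.
  have [||t tB E] := @MVT_segment R g dg x y xy; last by exists t => //; exact: B.
- by move=> t tI; apply: gd; apply: B; exact: subset_itv_oo_cc tI.
- by apply: continuous_in_subspaceT => t /set_mem /= /B /cg.
have B t : t \in `[y, x]%R -> `|t - x| <= `|y - x|.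
  by rewrite in_itv /= => /andP[? ?]; rewrite !ler0_norm ?subr_le0 ?(ltW yx)// lerN2
    lerD2r.
have [||t tB E] := @MVT_segment R g dg y x (ltW yx).
- by move=> t tI; apply: gd; apply: B; exact: subset_itv_oo_cc tI.
- by apply: continuous_in_subspaceT => t /set_mem /= /B /cg.
- by exists t; [exact: B|rewrite -opprB E -mulrN opprB].
Qed.

(** A condition at one point on prescribed partials [ux] and [uy]; being C^1 near [z] is this
    condition at all points near [z]. *)
Definition C1_pt u ux uy z := [/\
  is_derive z ((1, 0) : cd R 1) (u : _ -> R^o) (ux z : R^o),
  is_derive z ((0, 1) : cd R 1) (u : _ -> R^o) (uy z : R^o),
  {for z, continuous (ux : cd R 1 -> R)} & {for z, continuous (uy : cd R 1 -> R)}].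

(** The path from [z] to [w] turns at the corner [(z.1, w.2)], and the mean value theorem is applied
    on each leg. Balls of the sup norm are squares, so both legs stay where the hypothesis holds. *)
Lemma C1_increment u ux uy z : (\forall w \near z, C1_pt u ux uy w) ->
  \forall w \near z, exists a b : cd R 1,
    [/\ `|a - z| <= `|w - z|, `|b - z| <= `|w - z| &
      u w - u z = ux a * (w.1 - z.1) + uy b * (w.2 - z.2)].
Proof.
move=> /nbhs_ballP[e /= e0 he]; apply/nbhs_ballP; exists e => // w.
rewrite -!ball_normE /= -normrN opprB => wz.
have nE (v : cd R 1) : `|v| = Order.max `|v.1| `|v.2| by [].
have w1 : `|w.1 - z.1| <= `|w - z| by rewrite nE le_max lexx.
have w2 : `|w.2 - z.2| <= `|w - z| by rewrite nE le_max lexx orbT.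
have [t|a Ha Ea] := @mvt_unordered (fun s => u (s, w.2)) (fun s => ux (s, w.2)) z.1 w.1.
  move=> ht; apply: is_derive_line1.
  have [|//] := he (t, w.2).
  rewrite -ball_normE /= -normrN opprB nE /= gt_max.
  by rewrite (le_lt_trans ht) ?(le_lt_trans w1)// (le_lt_trans w2).
have [t|b Hb Eb] := @mvt_unordered (fun s => u (z.1, s)) (fun s => uy (z.1, s)) z.2 w.2.
  move=> ht; apply: is_derive_line2.
  have [|//] := he (z.1, t).
  rewrite -ball_normE /= -normrN opprB nE /= gt_max subrr normr0 e0 /=.
  by rewrite (le_lt_trans ht) ?(le_lt_trans w2).
exists (a, w.2), (z.1, b); split.
- by rewrite nE /= ge_max (le_trans Ha).
- by rewrite nE /= ge_max subrr normr0 normr_ge0 (le_trans Hb).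
- rewrite -Ea -Eb; case: (w) (z) => [? ?] [? ?] /=; ring.
Qed.

(** The two intermediate points become functions of [w]; being no farther from [z] than [w] is, they
    tend to [z]. *)
Lemma C1_mean_value u ux uy z : (\forall w \near z, C1_pt u ux uy w) ->
  exists a b : cd R 1 -> cd R 1,
    [/\ a w @[w --> z] --> z, b w @[w --> z] --> z &
      \forall w \near z,
        u w = u z + (ux (a w) * (w.1 - z.1) + uy (b w) * (w.2 - z.2))].
Proof.
move=> /C1_increment inc.
have /choice[ab hab] w : exists ab : cd R 1 * cd R 1,
    (exists a b : cd R 1, [/\ `|a - z| <= `|w - z|, `|b - z| <= `|w - z| &
      u w - u z = ux a * (w.1 - z.1) + uy b * (w.2 - z.2)]) ->
    [/\ `|ab.1 - z| <= `|w - z|, `|ab.2 - z| <= `|w - z| &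
      u w - u z = ux ab.1 * (w.1 - z.1) + uy ab.2 * (w.2 - z.2)].
  have [[a [b H]]|H] := pselect (exists a b : cd R 1,
    [/\ `|a - z| <= `|w - z|, `|b - z| <= `|w - z| &
      u w - u z = ux a * (w.1 - z.1) + uy b * (w.2 - z.2)]).
    by exists (a, b).
  by exists (z, z) => /H.
exists (fun w => (ab w).1), (fun w => (ab w).2); split.
- apply/cvgrPdist_lt => e e0.
  near=> w; rewrite distrC; have [|h _ _] := hab w; first by near: w.
  rewrite (le_lt_trans h)// distrC; near: w.
- apply/cvgrPdist_lt => e e0.
  near=> w; rewrite distrC; have [|_ h _] := hab w; first by near: w.
  rewrite (le_lt_trans h)// distrC; near: w.
- near=> w; have [|_ _ h] := hab w; first by near: w.
  by rewrite -h addrC subrK.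
Unshelve. all: by end_near. Qed.

Lemma C1_continuous u ux uy z : (\forall w \near z, C1_pt u ux uy w) ->
  {for z, continuous (u : cd R 1 -> R)}.
Proof.
move=> uC; have [_ _ cx cy] := nbhs_singleton uC.
have [a [b [az bz h]]] := C1_mean_value uC.
rewrite /continuous_at.
suff K : (fun w => u z + (ux (a w) * (w.1 - z.1) + uy (b w) * (w.2 - z.2))) @ z --> u z.
  by apply: cvg_trans K; apply: near_eq_cvg; apply: filterS h => w ->.
have {2}-> : u z = u z + (ux z * (z.1 - z.1) + uy z * (z.2 - z.2)).
  by rewrite !subrr !mulr0 !addr0.
apply: cvgD; first exact: cvg_cst.
have c1 : (fun w : cd R 1 => w.1 : R) @ z --> (z.1 : R) by exact: cvg_fst.
have c2 : (fun w : cd R 1 => w.2 : R) @ z --> (z.2 : R) by exact: cvg_snd.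
apply: cvgD; apply: cvgM.
- exact: (cvg_comp _ _ az cx).
- by apply: cvgB => //; exact: cvg_cst.
- exact: (cvg_comp _ _ bz cy).
- by apply: cvgB => //; exact: cvg_cst.
Unshelve. all: by end_near. Qed.

(** Divided by [h], the mean value formula consists of [ux] and [uy] at points tending to [p t],
    times the difference quotients of the coordinates of [p]; the limit is taken termwise. *)
Lemma C1_chain u ux uy (p : R -> cd R 1) t (d1 d2 : R) :
  (\forall w \near p t, C1_pt u ux uy w) ->
  is_derive t (1:R) (fun s => (p s).1 : R) d1 ->
  is_derive t (1:R) (fun s => (p s).2 : R) d2 ->
  is_derive t (1:R) (fun s => u (p s)) (ux (p t) * d1 + uy (p t) * d2).
Proof.
move=> uC p1 p2; have [_ _ cx cy] := nbhs_singleton uC.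
have [a [b [az bz h]]] := C1_mean_value uC.
have pt : p s @[s --> t] --> p t.
  rewrite [p t]surjective_pairing.
  under eq_fun do rewrite [p _]surjective_pairing.
  apply: (@cvg_pair R R R (nbhs t) (nbhs (p t).1) (nbhs (p t).2) _ _ _
    (fun s => (p s).1) (fun s => (p s).2)).
    by case: p1 => /derivable1_diffP/differentiable_continuous.
  by case: p2 => /derivable1_diffP/differentiable_continuous.
have pt0 : p (s *: (1:R) + t) @[s --> (0:R)] --> p t.
  have K : (fun s : R => s *: (1:R) + t) @ (0:R) --> 0 *: (1:R) + t.
    by apply: cvgD; [apply: cvgZr_tmp; exact: cvg_id|exact: cvg_cst].
  by rewrite scale0r add0r in K; exact: (cvg_comp _ _ K pt).
have pt0' : p (s *: (1:R) + t) @[s --> 0^'] --> p t.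
  apply: cvg_trans pt0; apply: cvg_app; exact: nbhs_dnbhs.
suff L : (fun h : R => h^-1 *: (((fun s => u (p s)) \o shift t) (h *: (1:R)) - u
  (p t)) : R) @ 0^' --> ux (p t) * d1 + uy (p t) * d2.
  by split; [apply/cvg_ex; exists (ux (p t) * d1 + uy (p t) * d2) | exact/cvg_lim].
have q1 : (fun h : R => h^-1 *: ((p (h *: (1:R) + t)).1 - (p t).1) : R) @ 0^' --> d1.
  by case: p1 => q <-; exact: q.
have q2 : (fun h : R => h^-1 *: ((p (h *: (1:R) + t)).2 - (p t).2) : R) @ 0^' --> d2.
  by case: p2 => q <-; exact: q.
suff K : (fun h : R => ux (a (p (h *: (1:R) + t))) *
  (h^-1 *: ((p (h *: (1:R) + t)).1 - (p t).1))
   + uy (b (p (h *: (1:R) + t))) * (h^-1 *: ((p (h *: (1:R) + t)).2 - (p t).2))) @ 0^'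
     --> ux (p t) * d1 + uy (p t) * d2.
  apply: cvg_trans K; apply: near_eq_cvg.
  have := pt0' _ h; rewrite /nbhs /=; apply: filterS => s /= ->.
  by rewrite /GRing.scale /=; ring.
apply: cvgD; apply: cvgM => //.
- exact: (cvg_comp _ _ (cvg_comp _ _ pt0' az) cx).
- exact: (cvg_comp _ _ (cvg_comp _ _ pt0' bz) cy).
Unshelve. all: by end_near. Qed.

End C1.

(** * Holomorphic functions *)

Section complex_limits.
Variable R : realType.
Local Notation C := (R[i]).

Lemma ReD (x y : C) : Re (x + y) = Re x + Re y. Proof. by case: x y => [? ?] []. Qed.
Lemma ImD (x y : C) : Im (x + y) = Im x + Im y. Proof. by case: x y => [? ?] []. Qed.
Lemma ReN (x : C) : Re (- x) = - Re x. Proof. by case: x. Qed.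
Lemma ImN (x : C) : Im (- x) = - Im x. Proof. by case: x. Qed.
Lemma ReM (x y : C) : Re (x * y) = Re x * Re y - Im x * Im y.
Proof. by case: x y => [? ?] []. Qed.
Lemma ImM (x y : C) : Im (x * y) = Re x * Im y + Im x * Re y.
Proof. by case: x y => [? ?] []. Qed.
Lemma ReV (x : C) : Re x^-1 = Re x / (Re x ^+ 2 + Im x ^+ 2).
Proof. by case: x. Qed.
Lemma ImV (x : C) : Im x^-1 = - Im x / (Re x ^+ 2 + Im x ^+ 2).
Proof. by case: x => a b; rewrite /= mulNr. Qed.
Lemma sqn_neq0 (x : C) : x != 0 -> Re x ^+ 2 + Im x ^+ 2 != 0.
Proof.
case: x => a b; rewrite eq_complex /=; apply: contraNneq => /eqP.
by rewrite paddr_eq0 ?sqr_ge0// !sqrf_eq0.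
Qed.
Definition ReImE := (ReD, ImD, ReN, ImN, ReM, ImM, ReV, ImV).

Lemma complex_ext (x y : C) : Re x = Re y -> Im x = Im y -> x = y.
Proof. by case: x y => [? ?] [? ?] /= -> ->. Qed.

Definition ccvg {T : Type} (F : set_system T) (f : T -> C) (l : C) :=
  (Re (f x) : R) @[x --> F] --> Re l /\ (Im (f x) : R) @[x --> F] --> Im l.

Section ccvg.
Context {T : Type} {F : set_system T} {FF : Filter F}.
Implicit Types (f g : T -> C).

Lemma ccvg_cst l : ccvg F (fun=> l) l.
Proof. by split; exact: cvg_cst. Qed.

Lemma ccvgD f g a b : ccvg F f a -> ccvg F g b -> ccvg F (fun x => f x + g x) (a + b).
Proof.
move=> [f1 f2] [g1 g2]; split; under eq_fun do rewrite ReImE; rewrite ReImE;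
  exact: cvgD.
Qed.

Lemma ccvgN f a : ccvg F f a -> ccvg F (fun x => - f x) (- a).
Proof.
move=> [f1 f2]; split; under eq_fun do rewrite ReImE; rewrite ReImE; exact: cvgN.
Qed.

Lemma ccvgB f g a b : ccvg F f a -> ccvg F g b -> ccvg F (fun x => f x - g x) (a - b).
Proof. by move=> fa gb; apply: ccvgD => //; exact: ccvgN. Qed.

Lemma ccvgM f g a b : ccvg F f a -> ccvg F g b -> ccvg F (fun x => f x * g x) (a * b).
Proof.
move=> [f1 f2] [g1 g2]; split; under eq_fun do rewrite ReImE; rewrite ReImE.
  by apply: cvgB; apply: cvgM.
by apply: cvgD; apply: cvgM.
Qed.

Lemma cvg_sqn f a : ccvg F f a ->
  (Re (f x) ^+ 2 + Im (f x) ^+ 2 : R) @[x --> F] --> Re a ^+ 2 + Im a ^+ 2.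
Proof. by move=> [f1 f2]; apply: cvgD; rewrite expr2; apply: cvgM. Qed.

Lemma ccvgV f a : a != 0 -> ccvg F f a -> ccvg F (fun x => (f x)^-1) a^-1.
Proof.
move=> /sqn_neq0 a0 fa; have [f1 f2] := fa.
split; under eq_fun do rewrite ReImE; rewrite ReImE; apply: cvgM => //.
- exact: cvgV (cvg_sqn fa).
- exact: cvgN.
- exact: cvgV (cvg_sqn fa).
Qed.

Lemma ccvg_real (f : T -> R) (a : R) : f @ F --> a -> ccvg F (fun x => (f x)%:C) a%:C.
Proof. by move=> fa; split => //=; exact: cvg_cst. Qed.

End ccvg.

Lemma ccvg_comp {T U : Type} (F : set_system T) (G : set_system U) (h : T -> U)
    (f : U -> C) l :
  h @ F --> G -> ccvg G f l -> ccvg F (f \o h) l.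
Proof. by move=> hG [f1 f2]; split; [exact: (cvg_comp _ _ hG f1)|exact:
  (cvg_comp _ _ hG f2)]. Qed.

Definition to_plane (z : C) : cd R 1 := (Re z, Im z).

Lemma ccvg_to_plane {T : Type} (F : set_system T) {FF : Filter F} (f : T -> C) l :
  ccvg F f l -> to_plane (f x) @[x --> F] --> to_plane l.
Proof.
move=> [f1 f2].
exact: (@cvg_pair T R R F (nbhs (Re l)) (nbhs (Im l)) _ _ _ (fun x => Re (f x))
  (fun x => Im (f x))).
Qed.

Definition cderive (t : R) (f : R -> C) (d : C) :=
  is_derive t (1:R) (fun s => Re (f s) : R) (Re d) /\
  is_derive t (1:R) (fun s => Im (f s) : R) (Im d).

(** The Cauchy-Riemann equations are built in: all four partials are read off from one complex
    derivative [df], which is continuous on [D]. *)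
Definition holo (D : set (cd R 1)) (f df : cd R 1 -> C) := forall z, D z ->
  C1_pt (fun z => Re (f z)) (fun z => Re (df z)) (fun z => - Im (df z)) z /\
  C1_pt (fun z => Im (f z)) (fun z => Im (df z)) (fun z => Re (df z)) z.

Variable D : set (cd R 1).

Lemma holo_cst (c : C) : holo D (fun=> c) (fun=> 0).
Proof.
move=> z Dz; split; split; rewrite /= ?oppr0;
  do ?[exact: cvg_cst | exact: is_derive_cst].
Qed.

Lemma holo_ccvg_deriv f df z : holo D f df -> D z -> ccvg (nbhs z) df (df z).
Proof. by move=> h /h[[_ _ ? _] [_ _ ? _]]. Qed.

Hypothesis oD : open D.

Lemma holo_ccvg f df z : holo D f df -> D z -> ccvg (nbhs z) f (f z).
Proof.
move=> h Dz; have nD : \forall w \near z, D w by exact: open_nbhs_nbhs.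
split.
- apply: (@C1_continuous _ _ (fun z => Re (df z)) (fun z => - Im (df z))).
  by apply: filterS nD => w /h[].
- apply: (@C1_continuous _ _ (fun z => Im (df z)) (fun z => Re (df z))).
  by apply: filterS nD => w /h[].
Qed.

Lemma holo_chain f df (p : R -> C) t d : holo D f df -> D (to_plane (p t)) ->
  cderive t p d -> cderive t (fun s => f (to_plane (p s))) (df (to_plane (p t)) * d).
Proof.
move=> h Dz [p1 p2].
have nD : \forall w \near to_plane (p t), D w by exact: open_nbhs_nbhs.
split.
- rewrite ReM -mulNr; apply: (@C1_chain _ (fun z => Re (f z)) (fun z => Re (df z))
    (fun z => - Im (df z)) (fun s => to_plane (p s))) => //.
  by apply: filterS nD => w /h[].
- rewrite ImM addrC; apply: (@C1_chain _ (fun z => Im (f z)) (fun z => Im (df z))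
    (fun z => Re (df z)) (fun s => to_plane (p s))) => //.
  by apply: filterS nD => w /h[].
Qed.

Lemma holoD f df g dg : holo D f df -> holo D g dg ->
  holo D (fun z => f z + g z) (fun z => df z + dg z).
Proof.
move=> hf hg z Dz; have [[a1 a2 _ _] [a3 a4 _ _]] := hf z Dz.
have [[b1 b2 _ _] [b3 b4 _ _]] := hg z Dz.
have [c1 c2] := ccvgD (holo_ccvg_deriv hf Dz) (holo_ccvg_deriv hg Dz).
split; split => //=; do ?[exact: cvgN].
- rewrite ReImE; under eq_fun do rewrite ReImE; exact: is_deriveD.
- rewrite ReImE opprD; under eq_fun do rewrite ReImE; exact: is_deriveD.
- rewrite ReImE; under eq_fun do rewrite ReImE; exact: is_deriveD.
- rewrite ReImE; under eq_fun do rewrite ReImE; exact: is_deriveD.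
Qed.

Lemma holoM f df g dg : holo D f df -> holo D g dg ->
  holo D (fun z => f z * g z) (fun z => df z * g z + f z * dg z).
Proof.
move=> hf hg z Dz; have [[a1 a2 _ _] [a3 a4 _ _]] := hf z Dz.
have [[b1 b2 _ _] [b3 b4 _ _]] := hg z Dz.
have [c1 c2] := ccvgD (ccvgM (holo_ccvg_deriv hf Dz) (holo_ccvg hg Dz))
  (ccvgM (holo_ccvg hf Dz) (holo_ccvg_deriv hg Dz)).
split; split => //=; do ?[exact: cvgN].
- rewrite !ReImE; under eq_fun do rewrite ReImE.
  apply: (is_derive_eq (is_deriveB (is_deriveM a1 b1) (is_deriveM a3 b3)));
    rewrite /GRing.scale /=; ring.
- rewrite !ReImE; under eq_fun do rewrite ReImE.
  apply: (is_derive_eq (is_deriveB (is_deriveM a2 b2) (is_deriveM a4 b4)));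
    rewrite /GRing.scale /=; ring.
- rewrite !ReImE; under eq_fun do rewrite ReImE.
  apply: (is_derive_eq (is_deriveD (is_deriveM a1 b3) (is_deriveM a3 b1)));
    rewrite /GRing.scale /=; ring.
- rewrite !ReImE; under eq_fun do rewrite ReImE.
  apply: (is_derive_eq (is_deriveD (is_deriveM a2 b4) (is_deriveM a4 b2)));
    rewrite /GRing.scale /=; ring.
Qed.

Lemma is_deriveV_plane (f : cd R 1 -> R) (z v : cd R 1) (d : R) : f z != 0 ->
  is_derive z v (f : _ -> R^o) (d : R^o) ->
  is_derive z v ((fun z => (f z)^-1) : _ -> R^o) (- (f z) ^- 2 * d : R^o).
Proof.
move=> f0 [h1 h2]; split; first exact: derivableV.
by rewrite deriveV // h2.
Qed.

Lemma holoV f df : (forall z, D z -> f z != 0) -> holo D f df ->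
  holo D (fun z => (f z)^-1) (fun z => - df z / f z ^+ 2).
Proof.
move=> f0 hf z Dz; have [[a1 a2 _ _] [a3 a4 _ _]] := hf z Dz.
have fz0 := f0 z Dz; have q0 := sqn_neq0 fz0.
have f20 : f z * f z != 0 by rewrite mulf_neq0.
have [c1 c2] : ccvg (nbhs z) (fun x => - df x / f x ^+ 2) (- df z / f z ^+ 2).
  rewrite expr2; under eq_fun do rewrite expr2.
  apply: (ccvgM (ccvgN (holo_ccvg_deriv hf Dz))).
  exact: (ccvgV f20 (ccvgM (holo_ccvg hf Dz) (holo_ccvg hf Dz))).
have i1 := is_deriveV_plane (f := fun z => Re (f z) * Re (f z) + Im (f z) * Im (f z)) q0
  (is_deriveD (is_deriveM a1 a1) (is_deriveM a3 a3)).
have i2 := is_deriveV_plane (f := fun z => Re (f z) * Re (f z) + Im (f z) * Im (f z)) q0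
  (is_deriveD (is_deriveM a2 a2) (is_deriveM a4 a4)).
have a3' : is_derive z ((1, 0) : cd R 1) ((fun z => - Im (f z)) : _ -> R^o)
  (- Im (df z) : R^o).
  exact: is_deriveN.
have a4' : is_derive z ((0, 1) : cd R 1) ((fun z => - Im (f z)) : _ -> R^o)
  (- Re (df z) : R^o).
  exact: is_deriveN.
have q1 : Re (f z) * Re (f z) + Im (f z) * Im (f z) != 0 by [].
(* The squared modulus of [f z * f z], which is the denominator that [ReV] and [ImV] produce for its
   inverse. *)
have q2 : (Re (f z) * Re (f z) - Im (f z) * Im (f z)) ^+ 2 +
  (Re (f z) * Im (f z) + Im (f z) * Re (f z)) ^+ 2 != 0.
  by have := sqn_neq0 f20; rewrite !ReImE.
split; split => //=; do ?[exact: cvgN].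
- rewrite expr2 !ReImE; under eq_fun do rewrite ReImE.
  apply: (is_derive_eq (is_deriveM a1 i1)); rewrite /GRing.scale /=; field;
    rewrite q1 andbT; exact: q2.
- rewrite expr2 !ReImE; under eq_fun do rewrite ReImE.
  apply: (is_derive_eq (is_deriveM a2 i2)); rewrite /GRing.scale /=; field;
    rewrite q1 andbT; exact: q2.
- rewrite expr2 !ReImE; under eq_fun do rewrite ReImE.
  apply: (is_derive_eq (is_deriveM a3' i1)); rewrite /GRing.scale /=; field;
    rewrite q1 andbT; exact: q2.
- rewrite expr2 !ReImE; under eq_fun do rewrite ReImE.
  apply: (is_derive_eq (is_deriveM a4' i2)); rewrite /GRing.scale /=; field;
    rewrite q1 andbT; exact: q2.
Qed.

End complex_limits.

(** * Integration over a circle *)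

Section cauchy.
Variable R : realType.
Local Notation C := (R[i]).
Local Notation mu := (@lebesgue_measure R).
Local Notation circ := (`[0%R, pi *+ 2]%classic : set R).

Lemma circ_lt : 0 < pi *+ 2 :> R. Proof. by rewrite mulrn_wgt0// pi_gt0. Qed.

Definition cint (f : R -> C) : C :=
  (\int[mu]_(x in circ) Re (f x))%R +i* (\int[mu]_(x in circ) Im (f x))%R.

Lemma integrable_circ (f : R -> R) : (forall x, {for x, continuous f}) ->
  mu.-integrable circ (EFin \o f).
Proof.
move=> fc; apply: continuous_compact_integrable; first exact: segment_compact.
exact: continuous_subspaceT.
Qed.

Definition ccont (f : R -> C) := forall x, ccvg (nbhs x) f (f x).

Lemma integrable_Re (f : R -> C) : ccont f ->
  mu.-integrable circ (EFin \o (fun x => Re (f x))).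
Proof. by move=> fc; apply: integrable_circ => x; case: (fc x). Qed.

Lemma integrable_Im (f : R -> C) : ccont f ->
  mu.-integrable circ (EFin \o (fun x => Im (f x))).
Proof. by move=> fc; apply: integrable_circ => x; case: (fc x). Qed.

Lemma cintD f g : ccont f -> ccont g -> cint (fun x => f x + g x) = cint f + cint g.
Proof.
move=> fc gc; apply: complex_ext; rewrite ReImE /=; under eq_Rintegral do rewrite ReImE.
  by rewrite RintegralD //; exact: integrable_Re.
by rewrite RintegralD //; exact: integrable_Im.
Qed.

Lemma cintZ (c : C) f : ccont f -> cint (fun x => c * f x) = c * cint f.
Proof.
move=> fc; have iR := integrable_Re fc; have iI := integrable_Im fc.
have iZ (r : R) (g : R -> R) : mu.-integrable circ (EFin \o g) ->
    mu.-integrable circ (EFin \o (fun x => r * g x)).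
  by move=> ig; exact: (@integrableZl _ _ _ mu circ _ r (EFin \o g)).
apply: complex_ext; rewrite ReImE /=; under eq_Rintegral do rewrite ReImE.
  by rewrite RintegralB ?RintegralZl //; exact: iZ.
by rewrite RintegralD ?RintegralZl //; exact: iZ.
Qed.

Lemma mu_circ : fine (mu circ) = pi *+ 2 :> R.
Proof. by rewrite lebesgue_measure_itv /= lte_fin circ_lt /= subr0. Qed.

Lemma Rintegral_circ_le (f : R -> R) (M : R) : (forall x, {for x, continuous f}) ->
  (forall x, circ x -> `|f x| <= M) -> `|\int[mu]_(x in circ) f x| <= M * (pi *+ 2).
Proof.
move=> fc fM; have fi := integrable_circ fc.
rewrite (le_trans (le_normr_Rintegral _ fi))// -[X in M * X]mu_circ -Rintegral_cst//.
apply: (@le_Rintegral _ _ _ mu circ (fun x => `|f x|) (fun=> M)) => //.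
- apply: integrable_circ => x; apply: cvg_norm; exact: fc.
- by apply: integrable_circ => x; exact: cvg_cst.
Qed.

Lemma Re_le_normc (z : C) : `|Re z| <= normc z.
Proof.
case: z => a b /=; rewrite -sqrtr_sqr ler_wsqrtr// lerDl; exact: sqr_ge0.
Qed.

Lemma Im_le_normc (z : C) : `|Im z| <= normc z.
Proof.
case: z => a b /=; rewrite -sqrtr_sqr ler_wsqrtr// lerDr; exact: sqr_ge0.
Qed.

Lemma normc_ge0 (z : C) : 0 <= normc z.
Proof. by case: z => a b; exact: sqrtr_ge0. Qed.

Lemma normc_le (z : C) : normc z <= `|Re z| + `|Im z|.
Proof.
case: z => a b /=; rewrite -[leRHS]ger0_norm ?addr_ge0// -sqrtr_sqr ler_wsqrtr//.
rewrite sqrrD !real_normK ?num_real// lerD2r lerDl mulrn_wge0// mulr_ge0//.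
Qed.

(** Real and imaginary parts are bounded separately, hence the constant 4 pi in place of the sharp 2
    pi. *)
Lemma normc_cint (f : R -> C) (M : R) : ccont f ->
  (forall x, circ x -> normc (f x) <= M) ->
  normc (cint f) <= M * (pi *+ 4).
Proof.
move=> fc fM; rewrite (le_trans (normc_le _))//=.
have -> : M * (pi *+ 4) = M * (pi *+ 2) + M * (pi *+ 2) by rewrite -mulrDr -mulrnDr.
apply: lerD; apply: Rintegral_circ_le.
- by move=> x; case: (fc x).
- by move=> x /fM; exact: le_trans (Re_le_normc _).
- by move=> x; case: (fc x).
- by move=> x /fM; exact: le_trans (Im_le_normc _).
Qed.

Definition expi (x : R) : C := cos x +i* sin x.

Lemma normc_expi x : normc (expi x) = 1.
Proof. by rewrite /= cos2Dsin2 sqrtr1. Qed.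

Lemma ccont_expi : ccont expi.
Proof. by move=> x; split; [exact: continuous_cos | exact: continuous_sin]. Qed.

Lemma expi2pi : expi (pi *+ 2) = expi 0.
Proof. by rewrite /expi cos2pi sin2pi cos0 sin0. Qed.

Lemma cderive_cst t (c : C) : cderive t (fun=> c) 0.
Proof. by split; exact: is_derive_cst. Qed.

Lemma cderive_expi t : cderive t expi ('i * expi t).
Proof.
split; rewrite ReImE /=.
  by apply: (is_derive_eq (is_derive_cos t)); rewrite mul0r mul1r sub0r.
by apply: (is_derive_eq (is_derive_sin t)); rewrite mul0r mul1r add0r.
Qed.

Lemma cderiveD t (f g : R -> C) (df dg : C) : cderive t f df -> cderive t g dg ->
  cderive t (fun x => f x + g x) (df + dg).
Proof.
by move=> [f1 f2] [g1 g2]; split; rewrite ReImE; under eq_fun do rewrite ReImE;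
  exact: is_deriveD.
Qed.

Lemma cderiveM t (f g : R -> C) (df dg : C) : cderive t f df -> cderive t g dg ->
  cderive t (fun x => f x * g x) (df * g t + f t * dg).
Proof.
move=> [f1 f2] [g1 g2]; split; rewrite !ReImE; under eq_fun do rewrite ReImE.
  by apply: (is_derive_eq (is_deriveB (is_deriveM f1 g1) (is_deriveM f2 g2)));
    rewrite /GRing.scale /=; ring.
by apply: (is_derive_eq (is_deriveD (is_deriveM f1 g2) (is_deriveM f2 g1)));
    rewrite /GRing.scale /=; ring.
Qed.

Lemma cderiveZ t (c : C) (f : R -> C) (df : C) : cderive t f df ->
  cderive t (fun x => c * f x) (c * df).
Proof.
by move=> fd; have := cderiveM (cderive_cst t c) fd; rewrite mul0r add0r.
Qed.

Lemma cderive_real (t : R) : cderive t (fun x => x%:C) 1.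
Proof. by split => /=; [exact: is_derive_id | exact: is_derive_cst]. Qed.

(** The fundamental theorem of calculus, with boundary terms that cancel. *)
Lemma Rintegral_circ_deriv (F f : R -> R) : (forall x, {for x, continuous f}) ->
  (forall x, is_derive x (1:R) F (f x)) -> F (pi *+ 2) = F 0 ->
  (\int[mu]_(x in circ) f x)%R = 0.
Proof.
move=> fc Fd F0.
have cF x : {for x, continuous F}.
  by have [h _] := Fd x; exact/differentiable_continuous/derivable1_diffP.
rewrite /Rintegral (continuous_FTC2 (F := F) circ_lt).
- by rewrite -EFinB F0 subrr.
- exact: continuous_subspaceT.
- split.
  + by move=> x _; case: (Fd x).
  + by apply: cvg_at_right_filter; exact: cF.
  + by apply: cvg_at_left_filter; exact: cF.
- by move=> x _; rewrite derive1E; case: (Fd x).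
Qed.

End cauchy.

(** * Cauchy's formula *)

(** The mean value theorem on [[0, 1]] evaluates [dG] only at an interior point. This matters
    because the vanishing of [dG t] will be proved by dividing by [t]. *)
Lemma constant_of_derive0 (R : realType) (G dG : R -> R) :
  (forall t : R, `](- 2^-1), (3 * 2^-1)[%classic t -> is_derive t (1:R) G (dG t)) ->
  (forall t, 0 < t < 1 -> dG t = 0) -> G 1 = G 0.
Proof.
move=> GD dG0.
have GD' (t : R) : 0 <= t <= 1 -> is_derive t (1:R) G (dG t).
  by move=> /andP[? ?]; apply: GD; rewrite /= in_itv /=; apply/andP; split; lra.
have lt01 : (0:R) < 1 by exact: ltr01.
have G1 (t : R) : t \in `]0, 1[%R -> is_derive t (1:R) G (dG t).
  by rewrite in_itv /= => /andP[? ?]; apply: GD'; rewrite !ltW.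
have G2 : {within `[0, 1]%classic, continuous G}.
  apply: continuous_in_subspaceT => t /set_mem /=; rewrite in_itv /= => /GD'[h _].
  exact/differentiable_continuous/derivable1_diffP.
have [t tI E] := MVT lt01 G1 G2.
apply/eqP; rewrite -subr_eq0; apply/eqP; rewrite E.
by move: tI; rewrite in_itv /= => /dG0 ->; rewrite mul0r.
Qed.

(** For [z = c + r e^(ix)] one has [dz / (z - (c + w)) = i * cauchy_ker r w x dx]: this is Cauchy's
    kernel expressed in the angle. *)
Definition cauchy_ker (R : realType) (r : R) (w : R[i]) (x : R) : R[i] :=
  r%:C * expi x / (r%:C * expi x - w).

Section cauchy_formula.
Variable R : realType.
Local Notation C := (R[i]).
Local Notation mu := (@lebesgue_measure R).
Local Notation circ := (`[0%R, pi *+ 2]%classic : set R).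
Variables (D : set (cd R 1)) (f df : cd R 1 -> C) (c w : C) (r : R).
Hypotheses (oD : open D) (hf : holo D f df) (r0 : 0 < r) (wr : normc w < r).
Hypothesis rD : forall z : C, normc (z - c) <= 3 * r -> D (to_plane z).

Local Notation ker := (cauchy_ker r w).
(* The radius [3 * r] leaves room for [t] in ]-1/2, 3/2[, so that 0 and 1 are
   interior points. *)
Let zeta (t x : R) : C := c + w + t%:C * (r%:C * expi x - w).
Let f1 (t x : R) := Re (f (to_plane (zeta t x)) * ker x).
(** The derivative of [f1] in [t]: differentiating [zeta] yields [r e^(ix) - w], which cancels the
    denominator of the kernel. *)
Let df1 (t x : R) := Re (df (to_plane (zeta t x)) * (r%:C * expi x)).

Lemma normc_real (a : R) : normc a%:C = `|a|.
Proof. by rewrite /= expr0n addr0 sqrtr_sqr. Qed.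

Lemma normc_rexpi (s : R) x : 0 < s -> normc (s%:C * expi x) = s.
Proof. by move=> s0; rewrite normcM normc_expi mulr1 normc_real gtr0_norm. Qed.

Lemma kernel_denom_neq0 x : r%:C * expi x - w != 0.
Proof.
apply: contraTneq wr => /eqP; rewrite subr_eq0 => /eqP <-.
by rewrite normc_rexpi// ltxx.
Qed.

(** The vector [zeta t x - c] combines [w] and [r e^(ix)], of modulus at most [r], with coefficients
    [1 - t] and [t] of modulus at most 3/2. *)
Let zeta_D (t x : R) : - 2^-1 <= t <= 3 * 2^-1 -> D (to_plane (zeta t x)).
Proof.
move=> /andP[t1 t2]; apply: rD.
have -> : zeta t x - c = (1 - t)%:C * w + t%:C * (r%:C * expi x).
  by rewrite /zeta rmorphB /=; ring.
rewrite (le_trans (le_normcD _ _))// !normcM !normc_real normc_expi mulr1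
  (gtr0_norm r0).
have t3 : `|1 - t| <= 3 * 2^-1 by rewrite ler_norml; lra.
have t4 : `|t| <= 3 * 2^-1 by rewrite ler_norml; lra.
have := ler_pM (normr_ge0 _) (normc_ge0 w) t3 (ltW wr).
have := ler_wpM2r (ltW r0) t4; lra.
Qed.

Let ccvg_rexpi (x : R) : ccvg (nbhs x) (fun x => r%:C * expi x) (r%:C * expi x).
Proof. apply: ccvgM; [exact: ccvg_cst | exact: ccont_expi]. Qed.

Lemma ccont_ker : ccont ker.
Proof.
move=> x; apply: ccvgM => //; apply: ccvgV; first exact: kernel_denom_neq0.
by apply: ccvgB => //; exact: ccvg_cst.
Qed.

Let ccvg_zeta (t x : R) : ccvg (nbhs (t, x)) (fun p : R * R => zeta p.1 p.2) (zeta t x).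
Proof.
apply: ccvgD; first exact: ccvg_cst.
apply: ccvgM; first by apply: ccvg_real; exact: cvg_fst.
apply: ccvgB; last exact: ccvg_cst.
exact: (@ccvg_comp _ _ _ _ _ (fun p : R * R => p.2) (fun x => r%:C * expi x) _ cvg_snd).
Qed.

Let ccvg_zeta2 (t x : R) : ccvg (nbhs x) (zeta t) (zeta t x).
Proof.
apply: ccvgD; first exact: ccvg_cst.
apply: ccvgM; first exact: ccvg_cst.
by apply: ccvgB; [exact: ccvg_rexpi|exact: ccvg_cst].
Qed.

(** Compactness of the rectangle of parameters gives the constant that dominates the differentiation
    under the integral sign. *)
Let df1_bounded : exists M : R, forall t x : R, - 2^-1 <= t <= 3 * 2^-1 -> circ x ->
  `|df1 t x| <= M.
Proof.
pose K := (`[(- 2^-1 : R), 3 * 2^-1] `*` `[(0:R), pi *+ 2]) : set (R * R).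
have [|||M [_ M1]] := @compact_EVT_max _ R (fun p : R * R => `|df1 p.1 p.2|) K.
- exists (0, 0); split => /=; rewrite in_itv /= ?lexx ?(ltW (circ_lt R))//.
  by apply/andP; split; lra.
- by apply: compact_setX; exact: segment_compact.
- apply: continuous_in_subspaceT => -[t x] /set_mem [/= tI xI].
  apply: cvg_norm.
  have zD : D (to_plane (zeta t x)) by apply: zeta_D; move: tI; rewrite in_itv.
  suff [] : ccvg (nbhs (t, x)) (fun p : R * R => df (to_plane (zeta p.1 p.2)) *
    (r%:C * expi p.2))
     (df (to_plane (zeta t x)) * (r%:C * expi x)) by [].
  apply: ccvgM.
    exact: (ccvg_comp (ccvg_to_plane (ccvg_zeta t x)) (holo_ccvg_deriv hf zD)).
  exact: (@ccvg_comp _ _ _ _ _ (fun p : R * R => p.2) (fun x => r%:C * expi x) _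
    cvg_snd).
- exists (`|df1 M.1 M.2|) => t x tI xI; apply: (M1 (t, x)).
  by apply/mem_set; split => //=; rewrite in_itv.
Qed.

Let f1_cont (t x : R) : - 2^-1 <= t <= 3 * 2^-1 -> {for x, continuous (f1 t)}.
Proof.
move=> /zeta_D zD.
suff [] : ccvg (nbhs x) (fun x => f (to_plane (zeta t x)) * ker x)
  (f (to_plane (zeta t x)) * ker x) by [].
apply: ccvgM; last exact: ccont_ker.
exact: (ccvg_comp (ccvg_to_plane (ccvg_zeta2 t x)) (holo_ccvg oD hf (zD x))).
Qed.

Let df1_cont (t x : R) : - 2^-1 <= t <= 3 * 2^-1 -> {for x, continuous (df1 t)}.
Proof.
move=> /zeta_D zD.
suff [] : ccvg (nbhs x) (fun x => df (to_plane (zeta t x)) * (r%:C * expi x))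
  (df (to_plane (zeta t x)) * (r%:C * expi x)) by [].
apply: ccvgM => //.
exact: (ccvg_comp (ccvg_to_plane (ccvg_zeta2 t x)) (holo_ccvg_deriv hf (zD x))).
Qed.

Let f1_derive (t x : R) : - 2^-1 <= t <= 3 * 2^-1 ->
  is_derive t (1:R) (fun t => f1 t x) (df1 t x).
Proof.
move=> /zeta_D zD.
have d1 : cderive t (fun t => zeta t x) (1 * (r%:C * expi x - w)).
  have := cderiveD (cderive_cst t (c + w))
    (cderiveM (cderive_real t) (cderive_cst t (r%:C * expi x - w))).
  by rewrite add0r mulr0 addr0.
have [d2 _] := cderiveM (holo_chain (p := fun t => zeta t x) oD hf (zD x) d1)
  (cderive_cst t (ker x)).
apply: (is_derive_eq d2); congr Re; rewrite /cauchy_ker; field;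
  exact: kernel_denom_neq0.
Qed.

(** Differentiating [f (zeta t x)] in [x] gives [i t] times [df (zeta t x) * r e^(ix)]. So the
    [t]-derivative of the integrand is also an [x]-derivative, of a function periodic in [x]. *)
Let f2_derive (t x : R) : - 2^-1 <= t <= 3 * 2^-1 -> t != 0 ->
  is_derive x (1:R) (fun x => t^-1 * Im (f (to_plane (zeta t x)))) (df1 t x).
Proof.
move=> /zeta_D zD t0.
have d1 : cderive x (zeta t) (t%:C * (r%:C * ('i * expi x))).
  have := cderiveD (cderive_cst x (c + w))
    (cderiveZ t%:C (cderiveD (cderiveZ r%:C (cderive_expi x)) (cderive_cst x (- w)))).
  by rewrite add0r addr0.
have [_ d2] := holo_chain oD hf (zD x) d1.
apply: (is_derive_eq (is_deriveM (is_derive_cst t^-1 x (1:R)) d2)).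
rewrite /GRing.scale /= mulr0 addr0 /df1.
have -> : df (to_plane (zeta t x)) * (t%:C * (r%:C * ('i * expi x))) =
   t%:C * (df (to_plane (zeta t x)) * (r%:C * expi x) * 'i) by ring.
rewrite ImM ImiRe [Im _]/= mul0r addr0 -[Re t%:C]/t mulKf //.
Qed.

Let zeta2pi t : zeta t (pi *+ 2) = zeta t 0.
Proof. by rewrite /zeta expi2pi. Qed.

(** The integral [G t] of [f1 t] links the two sides: [zeta 1] runs along the circle, while [zeta 0]
    stays at [c + w]. *)
Lemma cauchy_Re : (\int[mu]_(x in circ) Re (f (to_plane (c + r%:C * expi x)) * ker x) =
  \int[mu]_(x in circ) Re (f (to_plane (c + w)) * ker x))%R.
Proof.
pose G t := (\int[mu]_(x in circ) f1 t x)%R.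
pose dG t := (\int[mu]_(x in circ) df1 t x)%R.
have [M hM] := df1_bounded.
have M0 : 0 <= M.
  apply: le_trans (normr_ge0 _) (hM 0 0 _ _); first by lra.
  by rewrite /= in_itv /= lexx (ltW (circ_lt R)).
have in_I (t : R) : `](- 2^-1), (3 * 2^-1)[%classic t -> - 2^-1 <= t <= 3 * 2^-1.
  by rewrite /= in_itv /= => /andP[? ?]; rewrite !ltW.
have GD (t : R) : `](- 2^-1), (3 * 2^-1)[%classic t -> is_derive t (1:R) G (dG t).
  move=> tI.
  have H := @cvg_differentiation_under_integral R _ _ mu f1 circ (measurable_itv _)
    t (- 2^-1) (3 * 2^-1) tI _ _ (fun=> M) _ _ _.
  have E : (fun h : R => h^-1 *: ((G \o shift t) (h *: (1:R)) - G t)) =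
    (fun h : R => h^-1 *: (G (h + t) - G t)).
    by apply/funext => h /=; rewrite /GRing.scale /= mulr1.
  have E2 : (\int[mu]_(y in circ) partial1of2 f1 t y)%R = dG t.
    apply: eq_Rintegral => x _; rewrite partial1of2E.
    by case: (f1_derive x (in_I _ tI)).
  rewrite -E2.
  suff L : (fun h : R => h^-1 *: (G (h + t) - G t)) @ 0^' -->
    (\int[mu]_(y in circ) partial1of2 f1 t y)%R.
    split; first by rewrite /derivable E; apply/cvg_ex; eexists; exact: L.
    by rewrite /derive E; exact/cvg_lim.
  apply: H.
  - by move=> s /in_I sI; apply: integrable_circ => x; exact: f1_cont.
  - by move=> s x /in_I sI _; case: (f1_derive x sI).
  - by move=> _; exact: M0.
  - by apply: integrable_circ => x; exact: cvg_cst.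
  - move=> s x /in_I sI xI; rewrite partial1of2E.
    by case: (f1_derive x sI) => _ ->; exact: hM.
(* For [t] in []0, 1[], [f2_derive] exhibits a primitive of the integrand of [dG t] with equal
   values at 0 and 2 pi. *)
have G01 : G 1 = G 0.
  apply: (constant_of_derive0 GD) => t /andP[t0 t1].
  have tI : - 2^-1 <= t <= 3 * 2^-1 by apply/andP; split; lra.
  apply: (@Rintegral_circ_deriv _ (fun x => t^-1 * Im (f (to_plane (zeta t x))))
    (df1 t)).
  - by move=> x; exact: df1_cont.
  - by move=> x; apply: f2_derive => //; rewrite gt_eqF.
  - by rewrite zeta2pi.
have <- : G 1 = (\int[mu]_(x in circ) Re (f (to_plane (c + r%:C * expi x)) * ker x))%R.
  apply: eq_Rintegral => x _; rewrite /f1 /zeta; congr (Re (f (to_plane _) * _)).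
  by rewrite mul1r; ring.
rewrite G01; apply: eq_Rintegral => x _; rewrite /f1 /zeta;
  congr (Re (f (to_plane _) * _)).
by rewrite mul0r addr0.
Qed.

End cauchy_formula.

(** * Isolated zeros *)

Section isolated_zeros.
Variable R : realType.
Local Notation C := (R[i]).
Local Notation circ := (`[0%R, pi *+ 2]%classic : set R).

Lemma normc_ge_sub (a b : C) : normc a - normc b <= normc (a - b).
Proof. by rewrite lerBlDr -{1}(subrK b a); exact: le_normcD. Qed.

Lemma normc_gt0 (a : C) : a != 0 -> 0 < normc a.
Proof.
by move=> a0; rewrite lt_neqAle normc_ge0 andbT eq_sym;
  apply: contraNneq a0 => /eq0_normc ->.
Qed.

Lemma normcX (a : C) n : normc (a ^+ n) = normc a ^+ n.
Proof. by elim: n => [|n IH]; rewrite ?expr0 ?normc1// !exprS normcM IH. Qed.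

Lemma cvg_normc {T : Type} (F : set_system T) {FF : Filter F} (g : T -> C) l :
  ccvg F g l -> (normc (g x) : R) @[x --> F] --> (normc l : R).
Proof.
move=> gl; have E (z : C) : normc z = Num.sqrt (Re z ^+ 2 + Im z ^+ 2) by case: z.
under eq_fun do rewrite E; rewrite E.
exact: (cvg_comp _ _ (cvg_sqn gl) (@sqrt_continuous R _)).
Qed.

Lemma cint1 : cint (fun=> 1) = (pi *+ 2 : R)%:C.
Proof.
apply: complex_ext; rewrite /cint /= Rintegral_cst //; first by rewrite mu_circ mul1r.
by rewrite mul0r.
Qed.

(** * Power series expansion inside a fixed circle *)

Section fixed_circle.
Variables (D : set (cd R 1)) (f df : cd R 1 -> C) (c : C) (r : R).
Hypotheses (oD : open D) (hf : holo D f df) (r0 : 0 < r).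
Hypothesis rD : forall z : C, normc (z - c) <= 3 * r -> D (to_plane z).

Let phi (x : R) := f (to_plane (c + r%:C * expi x)).
Let e (x : R) : C := r%:C * expi x.

Lemma ccont_circle : ccont phi.
Proof.
move=> x; have zD : D (to_plane (c + e x)).
  by apply: rD; rewrite addrC addKr normc_rexpi//; have := r0; lra.
suff H : ccvg (nbhs x) (fun x => c + e x) (c + e x).
  exact: (ccvg_comp (ccvg_to_plane H) (holo_ccvg oD hf zD)).
apply: ccvgD; first exact: ccvg_cst.
by apply: ccvgM; [exact: ccvg_cst | exact: ccont_expi].
Qed.

(** The imaginary part is [cauchy_Re] applied to [- i f]. The integral of the kernel is left
    unevaluated; later it is only shown to be nonzero. *)
Lemma cauchy_formula w : normc w < r ->
  cint (fun x => phi x * cauchy_ker r w x) = f (to_plane (c + w)) * cint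
    (cauchy_ker r w).
Proof.
move=> wr; rewrite -cintZ; last exact: ccont_ker.
have hg := holoM oD (holo_cst (D := D) (- 'i)) hf.
apply: complex_ext; first exact: (cauchy_Re oD hf r0 wr rD).
have reIm (z k : C) : Re (- 'i * z * k) = Im (z * k).
  by case: z k => a b [p q] /=; ring.
have := cauchy_Re oD hg r0 wr rD.
under eq_Rintegral do rewrite reIm.
by under [in RHS]eq_Rintegral do rewrite reIm.
Qed.

(** At [w = 0] the kernel is the constant 1. *)
Lemma mean_value : cint phi = f (to_plane c) * (pi *+ 2)%:C.
Proof.
have w0 : normc (0 : C) < r by rewrite normc0.
have k1 x : cauchy_ker r 0 x = 1.
  by have := kernel_denom_neq0 r0 w0 x; rewrite /cauchy_ker subr0 => h; rewrite divff.
have := cauchy_formula w0; rewrite addr0 (_ : cauchy_ker r 0 = fun=> 1) ?cint1;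
  last exact/funext.
by under [in X in X = _]eq_fun do rewrite mulr1.
Qed.

(** This is 2 pi times the k-th Taylor coefficient of [f] at [c]. *)
Let a k := cint (fun x => phi x / e x ^+ k).
(** The tail of the power series divided by [w ^+ k], that is the sum of [a (k + i) * w ^+ i] over
    [i], in closed form. *)
Let rem w k := cint (fun x => phi x / e x ^+ k * cauchy_ker r w x).

Let e0 x : e x != 0.
Proof. by have := @kernel_denom_neq0 R 0 r r0 _ x; rewrite subr0 normc0; exact. Qed.

Let ccont_e : ccont e.
Proof. by move=> x; apply: ccvgM; [exact: ccvg_cst | exact: ccont_expi]. Qed.

Let ccont_eV k : ccont (fun x => (e x ^+ k)^-1).
Proof.
move=> x; apply: ccvgV; first by rewrite expf_neq0.
elim: k => [|k IH]; first exact: ccvg_cst.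
by rewrite exprS; under eq_fun do rewrite exprS; apply: ccvgM.
Qed.

(** One step of the geometric series of the kernel: [e / (e - w) = 1 + (w / e) * (e / (e - w))]. *)
Let remS w k : normc w < r -> rem w k = a k + w * rem w k.+1.
Proof.
move=> wr; rewrite /rem -cintZ; last first.
  by move=> x; apply: ccvgM; [apply: ccvgM;
    [exact: ccont_circle|exact: ccont_eV]|exact: ccont_ker].
rewrite -cintD; first last.
- move=> x; apply: ccvgM; first exact: ccvg_cst.
  by apply: ccvgM; [apply: ccvgM; [exact: ccont_circle|exact: ccont_eV]|exact:
    ccont_ker].
- by move=> x; apply: ccvgM; [exact: ccont_circle|exact: ccont_eV].
congr cint; apply/funext => x; rewrite /cauchy_ker -/(e x) exprS; field.
by rewrite (e0 x) expf_neq0 ?e0 //= (kernel_denom_neq0 r0 wr).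
Qed.

Let rem_expansion w n : normc w < r -> (forall k, (k < n)%N -> a k = 0) ->
  f (to_plane (c + w)) * cint (cauchy_ker r w) = w ^+ n * rem w n.
Proof.
move=> wr; elim: n => [|n IH] an.
  rewrite -cauchy_formula // mul1r; congr cint; apply/funext => x.
  by rewrite expr0 divr1.
rewrite IH; last by move=> k kn; apply: an; exact: ltnW.
by rewrite remS // an // add0r exprSr mulrA.
Qed.

Let ker_bound w x : normc w <= r / 8 -> normc (cauchy_ker r w x) <= 2.
Proof.
move=> w8; have wr : normc w < r by apply: le_lt_trans w8 _; have := r0; lra.
rewrite /cauchy_ker normcM normcV normc_rexpi//.
have h : r / 2 <= normc (e x - w).
  by apply: le_trans (normc_ge_sub _ _); rewrite normc_rexpi//; have := r0; lra.
rewrite ler_pdivrMr; last by apply: lt_le_trans h; have := r0; lra.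
by move: h; rewrite -/(e x); have := r0; lra.
Qed.

(** The kernel is [1 + w / (e x - w)], whose second term has modulus at most
    [(r / 8) / (r / 2) = 1 / 4]. Its integral is at most pi by [normc_cint], less than the 2 pi
    contributed by 1. *)
Let cint_ker_neq0 w : normc w <= r / 8 -> cint (cauchy_ker r w) != 0.
Proof.
move=> w8; have wr : normc w < r by apply: le_lt_trans w8 _; have := r0; lra.
apply/eqP => K0.
have wk : ccont (fun x => w / (e x - w)).
  move=> x; apply: ccvgM; first exact: ccvg_cst.
  apply: ccvgV; first exact: kernel_denom_neq0.
  by apply: ccvgB; [exact: ccont_e|exact: ccvg_cst].
have : cint (fun x => 1 + w / (e x - w)) = 0.
  rewrite -K0; congr cint; apply/funext => x; rewrite /cauchy_ker -/(e x).
  by field; exact: kernel_denom_neq0.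
rewrite cintD //; last by move=> x; exact: ccvg_cst.
rewrite cint1 => /eqP; rewrite addr_eq0 => /eqP H.
have := @normc_cint R _ (1 / 4) wk; rewrite -normcN -H normc_real.
have p0 := pi_gt0 R.
rewrite ger0_norm; last by rewrite mulrn_wge0// ltW.
have -> : pi *+ 4 = 4 * pi :> R by ring.
have -> : pi *+ 2 = 2 * pi :> R by ring.
suff h x : normc (w / (e x - w)) <= 1 / 4 by move=> /(_ (fun x _ => h x)); have := r0;
  lra.
rewrite normcM normcV.
have h : r / 2 <= normc (e x - w).
  by apply: le_trans (normc_ge_sub _ _); rewrite normc_rexpi//; have := r0; lra.
by rewrite ler_pdivrMr; have := r0; lra.
Qed.

(** The bound is uniform in [k]: [phi] has a maximal modulus on the circle, the kernel is at most 2,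
    and [e x ^+ k] has modulus [r ^+ k]. *)
Let rem_bound : exists2 B : R, 0 < B & forall w k, normc w <= r / 8 ->
  normc (rem w k) * r ^+ k <= B.
Proof.
have [|x0 _ hx0] := @EVT_max R (fun x => normc (phi x)) 0 (pi *+ 2) (ltW (circ_lt R)).
  apply: continuous_subspaceT => x.
  exact: (cvg_normc (ccont_circle x)).
(* The summand 1 keeps the bound positive even when [phi] vanishes. *)
exists ((normc (phi x0) * 2) * (pi *+ 4) + 1) => [|w k w8].
  by rewrite ltr_wpDl// !mulr_ge0// ?normc_ge0// mulrn_wge0// pi_ge0.
have wr : normc w < r by apply: le_lt_trans w8 _; have := r0; lra.
rewrite -ler_pdivlMr ?exprn_gt0//.
have := @normc_cint R (fun x => phi x / e x ^+ k * cauchy_ker r w x)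
  (normc (phi x0) * 2 / r ^+ k).
move=> /(_ _ _)/le_trans; apply.
- by move=> x; apply: ccvgM; [apply: ccvgM;
    [exact: ccont_circle|exact: ccont_eV]|exact: ccont_ker].
- move=> x xI; rewrite normcM [normc (phi x / _)]normcM normcV normcX normc_rexpi//.
  rewrite mulrAC ler_pM2r ?invr_gt0 ?exprn_gt0//.
  apply: ler_pM; rewrite ?normc_ge0 ?ker_bound //; exact: hx0.
- by rewrite mulrAC ler_pM2r ?invr_gt0 ?exprn_gt0// lerDl.
Qed.

(** Up to the nonzero integral of the kernel, [f] is [w ^+ k * (a k + w * rem w k.+1)] for the least
    [k] with [a k != 0], and the bracket is nonzero for small [w]. If all [a k] vanish, [f] is
    [w ^+ n * rem w n] for every [n], and this tends to 0. *)
Lemma zero_or_isolated :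
  (exists2 d : R, 0 < d & forall w, normc w < d -> f (to_plane (c + w)) = 0) \/
  (exists2 d : R, 0 < d & forall w, w != 0 -> normc w < d -> f (to_plane (c + w)) != 0).
Proof.
have [B B0 hB] := rem_bound.
have [[k0 ak0]|a0] := pselect (exists k, a k != 0); [right|left].
  have [k ak kmin] := ex_minnP (ex_intro (fun k => a k != 0) k0 ak0).
  have ak' := normc_gt0 ak.
  have d0 : 0 < normc (a k) * r ^+ k.+1 / B.
    by rewrite divr_gt0// mulr_gt0// exprn_gt0.
  (* The second bound ensures [|w| |rem w k.+1| < |a k|], by [rem_bound]. *)
  exists (Order.min (r / 8) (normc (a k) * r ^+ k.+1 / B)).
    by rewrite lt_min d0 divr_gt0.
  move=> w w0; rewrite lt_min => /andP[/ltW w8 wk].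
  have wr : normc w < r by apply: le_lt_trans w8 _; have := r0; lra.
  apply/eqP => fw.
  have := rem_expansion (w := w) (n := k) wr; rewrite fw mul0r => /(_ _)/esym/eqP.
  rewrite mulf_eq0 expf_eq0 (negbTE w0) andbF /= => /(_ _)/eqP.
  have an j : (j < k)%N -> a j = 0.
    by move=> jk; apply/eqP; apply: contraTT jk => /kmin; rewrite -leqNgt.
  move=> /(_ an); rewrite remS // => /eqP; rewrite addr_eq0 => /eqP H.
  move: wk; rewrite ltr_pdivlMr// H normcN normcM -mulrA => wk.
  have := hB w k.+1 w8 => /(ler_wpM2l (normc_ge0 w)); have := r0; lra.
exists (r / 8); first by rewrite divr_gt0.
move=> w /ltW w8; have wr : normc w < r by apply: le_lt_trans w8 _; have := r0; lra.
have a0' k : a k = 0.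
  by apply/eqP; apply: contrapT => /negP ak; apply: a0; exists k.
apply/eqP; have := cint_ker_neq0 w8; set F := f _ => K0.
suff : F * cint (cauchy_ker r w) == 0 by rewrite mulf_eq0 (negbTE K0) orbF.
set G := F * _; apply/eqP/eq0_normc/eqP; rewrite eq_le normc_ge0 andbT.
(* As [2 |w| <= r], [rem_bound] even bounds [normc G * 2 ^+ n]; linear growth is enough for the
   Archimedean contradiction. *)
have GN n : normc G * n%:R <= B.
  apply: (@le_trans _ _ (normc G * 2 ^+ n)).
    by rewrite ler_wpM2l ?normc_ge0// -natrX ler_nat ltnW// ltn_expl.
  have -> : G = w ^+ n * rem w n by apply: rem_expansion.
  apply: le_trans (hB w n w8); rewrite normcM normcX mulrAC -exprMn mulrC ler_wpM2l
    ?normc_ge0//.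
  apply: lerXn2r; rewrite ?nnegrE ?mulr_ge0 ?normc_ge0 ?(ltW r0)//; have := r0; lra.
rewrite leNgt; apply/negP => G0.
have := GN (Num.truncn (B / normc G)).+1.
have := @truncnS_gt R (B / normc G); rewrite ltr_pdivrMr// mulrC; have := r0; lra.
Qed.

End fixed_circle.
End isolated_zeros.

(** * The identity theorem and Hurwitz's theorem *)

Section hurwitz.
Variable R : realType.
Local Notation C := (R[i]).

Definition of_plane (z : cd R 1) : C := z.1 +i* z.2.

Lemma to_planeK (z : C) : of_plane (to_plane z) = z. Proof. by case: z. Qed.

Lemma of_planeK (z : cd R 1) : to_plane (of_plane z) = z. Proof. by case: z. Qed.

Lemma norm_to_plane_le (z : C) : `|to_plane z| <= normc z.
Proof. by rewrite /Num.norm /= ge_max Re_le_normc Im_le_normc. Qed.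

Lemma normc_of_plane_le (z : cd R 1) : normc (of_plane z) <= 2 * `|z|.
Proof.
apply: le_trans (normc_le _) _; rewrite mulr_natl mulr2n.
by apply: lerD; rewrite /Num.norm /= le_max lexx ?orbT.
Qed.

(** Neighbourhoods in [cd R 1] are given by sup-norm squares, Cauchy's formula by round discs; this
    lemma and the next translate between them. *)
Lemma nbhs_disc (z : cd R 1) (P : set (cd R 1)) : nbhs z P ->
  exists2 d : R, 0 < d & forall w : C, normc w < d -> P (to_plane (of_plane z + w)).
Proof.
move=> /nbhs_ballP[d /= d0 hd]; exists d => // w wd; apply: hd.
rewrite -ball_normE /=; apply: le_lt_trans wd.
have -> : z - to_plane (of_plane z + w) = to_plane (- w).
  by case: z w => a b [p q]; congr (_, _) => /=; ring.
by apply: le_trans (norm_to_plane_le _) _; rewrite normcN.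
Qed.

Lemma disc_nbhs (z : cd R 1) (P : set (cd R 1)) (d : R) : 0 < d ->
  (forall w : C, normc w < d -> P (to_plane (of_plane z + w))) -> nbhs z P.
Proof.
move=> d0 hd; apply/nbhs_ballP; exists (d / 2); first by rewrite /= divr_gt0.
move=> w; rewrite -ball_normE /= distrC => wz.
rewrite -(of_planeK w) -(subrK (of_plane z) (of_plane w)) addrC; apply: hd.
have -> : of_plane w - of_plane z = of_plane (w - z) by case: w z {wz} => a b [p q].
by apply: le_lt_trans (normc_of_plane_le _) _; rewrite -ltr_pdivlMl// mulrC.
Qed.

Lemma holo_subset (D E : set (cd R 1)) f df : E `<=` D -> holo D f df -> holo E f df.
Proof. by move=> ED hf z /ED; exact: hf. Qed.

Section fixed_function.
Variables (D : set (cd R 1)) (f df : cd R 1 -> C).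
Hypotheses (oD : open D) (hf : holo D f df).

Lemma holo_zero_or_isolated z : D z ->
  (\forall w \near z, f w = 0) \/ (\forall w \near z^', f w != 0).
Proof.
move=> Dz; have [|d d0 hd] := @nbhs_disc z D; first exact: open_nbhs_nbhs.
(* A quarter of the radius, because the circle lemmas ask for a disc of radius [3 * r] inside the
   domain. *)
have r0 : 0 < d / 4 by rewrite divr_gt0.
have [|[e e0 he]|[e e0 he]] := @zero_or_isolated R D f df (of_plane z) (d / 4) oD hf r0.
- move=> w wd; rewrite -(subrK (of_plane z) w) addrC; apply: hd.
  by apply: le_lt_trans wd _; lra.
- by left; exact: disc_nbhs e0 he.
- right; apply: (@disc_nbhs z (fun w => w != z -> f w != 0) _ e0) => w we wz.
  apply: he => //; apply: contraNneq wz => ->.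
  by rewrite addr0 of_planeK.
Qed.

(** The set [Z] of points near which [f] vanishes is open, and it is relatively closed because a
    limit point of [Z] outside [Z] would be an isolated zero or a point with no zeros around it. *)
Lemma identity_theorem : connected D ->
  (exists2 z, D z & \forall w \near z, f w = 0) -> forall z, D z -> f z = 0.
Proof.
move=> cD [z0 Dz0 hz0].
pose Z : set (cd R 1) := [set z | \forall w \near z, f w = 0].
have oZ : open Z.
  by rewrite openE => z /= /nbhs_interior; apply: filterS => w; exact.
suff <- : D `&` Z = D by move=> z [_ /nbhs_singleton].
apply: cD; first by exists z0.
- by exists Z.
- exists (closure Z); first exact: closed_closure.
  apply/seteqP; split => z [Dz hz]; split => //; first exact: subset_closure.
  have [//|iso] := holo_zero_or_isolated Dz.
  have [w [wZ hw]] := hz _ iso.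
  have [wz|wz] := eqVneq w z; first by rewrite -wz.
  by have /nbhs_singleton fw := wZ; move: (hw wz); rewrite fw eqxx.
Qed.

End fixed_function.

(** If [f y] had no zero near [z0], the mean value property of its inverse would bound
    [1 / |f y z0|] by the values on a small circle. For [y] near [y0] this fails, since [f y z0] is
    nearly 0 while [f y] stays away from 0 on the circle. *)
Lemma hurwitz (Y : topologicalType) (D : set (cd R 1)) (f df : Y -> cd R 1 -> C)
    (y0 : Y) (z0 : cd R 1) (W : set (cd R 1)) :
  open D -> (forall y, holo D (f y) (df y)) -> D z0 ->
  (forall z, D z -> ccvg (nbhs (y0, z)) (fun p : Y * cd R 1 => f p.1 p.2) (f y0 z)) ->
  f y0 z0 = 0 -> (\forall w \near z0^', f y0 w != 0) -> nbhs z0 W ->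
  \forall y \near y0, exists z, [/\ D z, W z & f y z = 0].
Proof.
move=> oD hf Dz0 fc fz0 iso nW.
(* Working in the interior of [W] forces the zero to lie in [W]. *)
pose D1 := D `&` W^°.
have oD1 : open D1 by apply: openI => //; exact: open_interior.
have hf1 y : holo D1 (f y) (df y) by apply: holo_subset (hf y); exact: subIsetl.
have [|d d0 hd] := @nbhs_disc z0 (D1 `&` [set w | w != z0 -> f y0 w != 0]).
  apply: filterI; last exact: iso.
  by apply: open_nbhs_nbhs; split => //; split => //; exact: nW.
pose c := of_plane z0; pose r := d / 4.
have r0 : 0 < r by rewrite divr_gt0.
have rD z : normc (z - c) <= 3 * r -> D1 (to_plane z).
  move=> h; rewrite -(subrK c z) addrC; apply: (proj1 (hd (z - c) _)).
  by apply: le_lt_trans h _; rewrite /r; lra.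
pose g (x : R) := c + r%:C * expi x.
have gD x : D1 (to_plane (g x)).
  by apply: rD; rewrite addrC addKr normc_rexpi//; lra.
have g0 x : f y0 (to_plane (g x)) != 0.
  have [|_] := hd (r%:C * expi x); first by rewrite normc_rexpi// /r; lra.
  apply; apply/eqP => /(congr1 of_plane); rewrite to_planeK => /eqP.
  rewrite -subr_eq0 addrC addKr => /eqP h.
  by have := normc_rexpi x r0; rewrite h normc0 => h2; move: r0; rewrite -h2 ltxx.
have [|x1 _ hx1] := @EVT_min R (fun x => normc (f y0 (to_plane (g x)))) 0 (pi *+ 2)
  (ltW (circ_lt R)).
  apply: continuous_subspaceT => x; apply: cvg_normc.
  exact: (@ccont_circle R D1 (f y0) (df y0) c r oD1 (hf1 y0) r0 rD).
set m := normc (f y0 (to_plane (g x1))) in hx1.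
have m0 : 0 < m by exact: normc_gt0.
(* Compactness of the interval of angles makes the neighbourhood of [y0] independent of the
   angle. *)
have near_circ : \forall y \near y0, forall x : R, `[0%R, pi *+ 2]%classic x ->
  m / 2 < normc (f y (to_plane (g x))).
  have := (compact_near_coveringP (`[(0:R), pi *+ 2]%classic)).1
    (@segment_compact R 0 (pi *+ 2)).
  move=> /(_ Y (nbhs y0) (fun y x => m / 2 < normc (f y (to_plane (g x)))) _); apply.
  move=> x xI.
  have gx : ccvg (nbhs x) g (g x).
    apply: ccvgD; first exact: ccvg_cst.
    by apply: ccvgM; [exact: ccvg_cst | exact: ccont_expi].
  have pair : (fun p : R * Y => (p.2, to_plane (g p.1))) @ (x, y0) -->
    (y0, to_plane (g x)).
    apply: (@cvg_pair (R * Y)%type Y (cd R 1) (nbhs (x, y0)) (nbhs y0)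
      (nbhs (to_plane (g x))) _ _ _ (fun p => p.2) (fun p => to_plane (g p.1))).
      exact: cvg_snd.
    apply: (cvg_comp (fun p : R * Y => p.1) (fun x => to_plane (g x)) cvg_fst).
    exact: ccvg_to_plane.
  have := cvg_normc (ccvg_comp pair (fc _ (proj1 (gD x)))).
  have mx : m / 2 < normc (f y0 (to_plane (g x))).
    by apply: lt_le_trans (hx1 x xI); lra.
  by move=> K; exact: (cvgr_gt _ (K _) _ mx).
have near_z0 : \forall y \near y0, normc (f y z0) < m / 4.
  have pair : (fun y : Y => (y, z0)) @ y0 --> (y0, z0).
    apply: (@cvg_pair Y Y (cd R 1) (nbhs y0) (nbhs y0) (nbhs z0) _ _ _ id (fun=> z0)).
      exact: cvg_id.
    exact: cvg_cst.
  have := cvg_normc (ccvg_comp pair (fc _ Dz0)); rewrite fz0 normc0.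
  have m4 : 0 < m / 4 by rewrite divr_gt0.
  by move=> K; exact: (cvgr_lt _ (K _) _ m4).
near=> y.
have h1 : forall x : R, `[0%R, pi *+ 2]%classic x ->
  m / 2 < normc (f y (to_plane (g x))) by near: y.
have h2 : normc (f y z0) < m / 4 by near: y.
apply: contrapT => nz.
have fn z : D1 z -> f y z != 0.
  by move=> [Dz /interior_subset Wz]; apply/eqP => fz; apply: nz; exists z.
have hi := holoV oD1 fn (hf1 y).
have := mean_value oD1 hi r0 rD; rewrite of_planeK -/c => mv.
have := @normc_cint R _ (2 / m) (ccont_circle oD1 hi r0 rD).
rewrite mv normcM normcV normc_real.
have D1z0 : D1 z0 by have := rD c; rewrite subrr normc0 of_planeK; apply;
  rewrite mulr_ge0// ltW.
have n0 : 0 < normc (f y z0) by apply: normc_gt0; exact: fn.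
have p0 := pi_gt0 R.
rewrite ger0_norm; last by rewrite mulrn_wge0// ltW.
have B : forall x : R, `[0%R, pi *+ 2]%classic x ->
  normc (f y (to_plane (c + r%:C * expi x)))^-1 <= 2 / m.
  move=> x /h1 h; rewrite normcV -[2 / m]invf_div lef_pV2 ?posrE ?ltW// ?divr_gt0//.
  by apply: lt_trans h; rewrite divr_gt0.
move=> /(_ B).
(* The factor 2 lost in [normc_cint] turns [2 / m] into [4 / m], which is why [near_z0] asks for
   [m / 4]. *)
have -> : 2 / m * (pi *+ 4) = 4 / m * (pi *+ 2) by ring.
rewrite ler_pM2r; last by rewrite mulrn_wgt0.
move=> h3.
move: h2; rewrite ltNge => /negP; apply.
by rewrite -[leLHS]invf_div -[leRHS]invrK lef_pV2 ?posrE ?divr_gt0 ?invr_gt0.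
Unshelve. all: by end_near. Qed.

End hurwitz.

(** * Cayley-Dickson algebras *)

Section cayley_dickson.
Variable R : realType.

Fixpoint cdre n : cd R n -> R :=
  match n with
  | 0 => fun x : R^o => x
  | m.+1 => fun x : cd R m * cd R m => cdre x.1
  end.

Fixpoint cddot n : cd R n -> cd R n -> R :=
  match n with
  | 0 => fun x y : R^o => x * y
  | m.+1 => fun x y : cd R m * cd R m => cddot x.1 y.1 + cddot x.2 y.2
  end.

Lemma scaleRo (k : R) (x : R^o) : k *: x = k * x. Proof. by []. Qed.

Lemma cdsqn_ge0 n (x : cd R n) : 0 <= cdsqn x.
Proof. by elim: n x => [|n IH] x /=; [exact: sqr_ge0|rewrite addr_ge0]. Qed.

Lemma cdsqn_eq0 n (x : cd R n) : cdsqn x = 0 -> x = 0.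
Proof.
elim: n x => [|n IH] x /=; first by move/eqP; rewrite sqrf_eq0 => /eqP.
case: x => a b /= /eqP; rewrite paddr_eq0 ?cdsqn_ge0// => /andP[/eqP/IH -> /eqP/IH ->].
by [].
Qed.

Lemma cdsqn0 n : cdsqn (0 : cd R n) = 0.
Proof. by elim: n => [|n IH] /=; [rewrite expr0n|rewrite IH addr0]. Qed.

Lemma norm_le_cdsqn n (x : cd R n) : `|x| ^+ 2 <= cdsqn x.
Proof.
elim: n x => [|n IH] x; first by rewrite /= real_normK ?num_real.
have -> : `|x| = Order.max `|x.1| `|x.2| by [].
rewrite maxEle /=; case: ifP => _.
  by apply: le_trans (IH x.2) _; rewrite lerDr cdsqn_ge0.
by apply: le_trans (IH x.1) _; rewrite lerDl cdsqn_ge0.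
Qed.

Lemma cdconjN n (x : cd R n) : cdconj (- x) = - cdconj x.
Proof. by elim: n x => [|n IH] x //=; rewrite IH. Qed.

Lemma cdconj0 n : cdconj (0 : cd R n) = 0.
Proof. by elim: n => [|n IH] //=; rewrite IH oppr0. Qed.

(** Both sides are treated together because the doubling formula swaps the order of some factors;
    the same holds for signs and scalars below. *)
Lemma cdmulx0 n (x : cd R n) : cdmul x 0 = 0 /\ cdmul 0 x = 0.
Proof.
elim: n x => [|n IH] x /=; first by rewrite mulr0 mul0r.
by rewrite cdconj0 !(fun x => (IH x).1) !(fun x => (IH x).2) subrr addr0.
Qed.

Lemma cdmulr0 n (x : cd R n) : cdmul x 0 = 0. Proof. exact: (cdmulx0 x).1. Qed.

Lemma cdmulNx n (x y : cd R n) : cdmul (- x) y = - cdmul x y /\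
  cdmul y (- x) = - cdmul y x.
Proof.
elim: n x y => [|n IH] x y /=; first by rewrite mulNr mulrN.
rewrite !cdconjN !(fun x y => (IH x y).1) !(fun x y => (IH x y).2).
by split; congr (_, _); rewrite -?opprD ?opprK.
Qed.

Lemma cdmulNl n (x y : cd R n) : cdmul (- x) y = - cdmul x y.
Proof. exact: (cdmulNx x y).1. Qed.

Lemma cdconjZ n k (x : cd R n) : cdconj (k *: x) = k *: cdconj x.
Proof.
by elim: n x => [|n IH] x //=; rewrite IH -scalerN.
Qed.

Lemma cdmulZx n k (x y : cd R n) : cdmul (k *: x) y = k *: cdmul x y /\
  cdmul y (k *: x) = k *: cdmul y x.
Proof.
elim: n x y => [|n IH] x y /=; first by rewrite /GRing.scale /= mulrA mulrCA.
rewrite !cdconjZ !(fun x y => (IH x y).1) !(fun x y => (IH x y).2).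
by split; congr (_, _); rewrite -?scalerBr -?scalerDr.
Qed.

Lemma cdmulZl n k (x y : cd R n) : cdmul (k *: x) y = k *: cdmul x y.
Proof. exact: (cdmulZx k x y).1. Qed.

Lemma cdsqnZ n k (x : cd R n) : cdsqn (k *: x) = k ^+ 2 * cdsqn x.
Proof.
elim: n x => [|n IH] x /=; first by rewrite exprMn.
by rewrite !IH mulrDr.
Qed.

Lemma cdsqnN n (x : cd R n) : cdsqn (- x) = cdsqn x.
Proof. by rewrite -scaleN1r cdsqnZ expr2 mulN1r opprK mul1r. Qed.

Lemma cdsqn_conj n (x : cd R n) : cdsqn (cdconj x) = cdsqn x.
Proof. by elim: n x => [|n IH] x //=; rewrite IH cdsqnN. Qed.

Lemma cdreZ n k (x : cd R n) : cdre (k *: x) = k * cdre x.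
Proof. by elim: n x => [|n IH] x //=. Qed.

Lemma cdreN n (x : cd R n) : cdre (- x) = - cdre x.
Proof. by elim: n x => [|n IH] x //=. Qed.

Lemma cdreD n (x y : cd R n) : cdre (x + y) = cdre x + cdre y.
Proof. by elim: n x y => [|n IH] x y //=. Qed.

Lemma cdre1 n : cdre (cd1 R n) = 1.
Proof. by elim: n. Qed.

Lemma cddotNl n (x y : cd R n) : cddot (- x) y = - cddot x y.
Proof. by elim: n x y => [|n IH] x y /=; [rewrite mulNr|rewrite !IH opprD]. Qed.

Lemma cddotZl n k (x y : cd R n) : cddot (k *: x) y = k * cddot x y.
Proof. by elim: n x y => [|n IH] x y /=; [rewrite mulrA|rewrite !IH mulrDr]. Qed.

Lemma cddotDl n (x y z : cd R n) : cddot (x + y) z = cddot x z + cddot y z.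
Proof.
by elim: n x y z => [|n IH] x y z /=; [rewrite mulrDl|rewrite !IH addrACA].
Qed.

Lemma cdsqnD n (x y : cd R n) : cdsqn (x + y) = cdsqn x + cdsqn y + 2 * cddot x y.
Proof.
elim: n x y => [|n IH] x y /=; first by ring.
by rewrite !IH; ring.
Qed.

Lemma cddotxx n (x : cd R n) : cddot x x = cdsqn x.
Proof. by elim: n x => [|n IH] x //=; rewrite !IH. Qed.

Lemma cddot1 n (x : cd R n) : cddot (cd1 R n) x = cdre x.
Proof.
have cddot0 m (y : cd R m) : cddot 0 y = 0.
  by have := cddotZl 0 0 y; rewrite scaler0 mul0r.
by elim: n x => [|n IH] x /=; rewrite ?mul1r// IH cddot0 addr0.
Qed.

Lemma cdsqn1 n : cdsqn (cd1 R n) = 1.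
Proof. by rewrite -cddotxx cddot1 cdre1. Qed.

Lemma cddotZr n k (x y : cd R n) : cddot x (k *: y) = k * cddot x y.
Proof.
by elim: n x y => [|n IH] x y /=; [rewrite mulrCA|rewrite !IH mulrDr].
Qed.

(** * Identities in C, H and O, imaginary units and slice points *)

Variable A : algebra_kind.
Local Notation V := (alg R A).
Local Notation one := (cd1 R (doublings A)).

(** Octonions are only alternative, so this case of associativity, on which right division rests, is
    checked in coordinates. *)
Lemma cdmulKr (x y : V) : cdmul (cdmul x (cdconj y)) y = cdsqn y *: x.
Proof.
case: A x y => /=.
- case=> a b [a' b']; congr (_, _); rewrite /GRing.scale /=; ring.
- case=> [[a b] [c d]] [[a' b'] [c' d']]; congr (_, _); congr (_, _);
    rewrite /GRing.scale /=; ring.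
- case=> [[[a b] [c d]] [[e f] [g h]]] [[[a' b'] [c' d']] [[e' f'] [g' h']]].
  by congr (_, _); congr (_, _); congr (_, _); rewrite /GRing.scale /=; ring.
Qed.

Lemma cdconjK n (x : cd R n) : cdconj (cdconj x) = x.
Proof.
elim: n x => [|n IH] x //=; rewrite IH opprK; exact: (esym (surjective_pairing _)).
Qed.

Lemma cdmulVKr (x y : V) : cdmul (cdmul x y) (cdconj y) = cdsqn y *: x.
Proof. by rewrite -{1}(cdconjK y) cdmulKr cdsqn_conj. Qed.

Lemma cdre_mul_conj (x y : V) : cdre (cdmul x (cdconj y)) = cddot x y.
Proof.
case: A x y => /=.
- case=> a b [a' b'] /=; ring.
- case=> [[a b] [c d]] [[a' b'] [c' d']] /=; ring.
- case=> [[[a b] [c d]] [[e f] [g h]]] [[[a' b'] [c' d']] [[e' f'] [g' h']]] /=; ring.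
Qed.

Lemma pair_ext (T U : Type) (x y : T * U) : x.1 = y.1 -> x.2 = y.2 -> x = y.
Proof. by case: x y => [? ?] [? ?] /= -> ->. Qed.

(** The quadratic equation of [x], with trace [2 * cdre x] and norm [cdsqn x]. *)
Lemma cdmul_sqr (x : V) : cdmul x x = (2 * cdre x) *: x - cdsqn x *: one.
Proof.
case: A x => /=.
- by case=> a b; apply: pair_ext; rewrite /= !scaleRo; ring.
- by case=> [[a b] [c d]]; apply: pair_ext; apply: pair_ext; rewrite /= !scaleRo; ring.
- case=> [[[a b] [c d]] [[e f] [g h]]].
  by apply: pair_ext; apply: pair_ext; apply: pair_ext; rewrite /= !scaleRo; ring.
Qed.

Lemma cdconjE n (x : cd R n) : cdconj x = (2 * cdre x) *: cd1 R n - x.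
Proof.
elim: n x => [|n IH] x /=; first by rewrite /GRing.scale /=; ring.
by apply: pair_ext; rewrite /= ?IH ?scaler0 ?sub0r.
Qed.

(** By the quadratic equation, [J^2 = -1] makes [2 Re(J) J] real. If [Re(J)] were nonzero, [J] would
    be a real number of square -1. *)
Lemma imag_unitsP (J : V) : imag_units J <-> cdre J = 0 /\ cdsqn J = 1.
Proof.
rewrite /imag_units /= cdmul_sqr; split; last first.
  by move=> [-> ->]; rewrite mulr0 scale0r sub0r scale1r.
move=> H.
have E : (2 * cdre J) *: J = (cdsqn J - 1) *: one.
  by rewrite scalerBl scale1r -H addrC subrK.
have [r0|r0] := eqVneq (cdre J) 0.
  split=> //; move: E; rewrite r0 mulr0 scale0r => /(congr1 (@cdre _)).
  rewrite cdreZ cdre1 mulr1 -(scale0r one) cdreZ mul0r => /esym/eqP.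
  by rewrite subr_eq0 => /eqP.
exfalso; pose s := (2 * cdre J)^-1 * (cdsqn J - 1).
have Js : J = s *: one.
  rewrite -scalerA -E scalerA mulVf ?scale1r//.
  by rewrite mulf_neq0.
move: H; rewrite Js cdreZ cdre1 mulr1 cdsqnZ cdsqn1 mulr1 scalerA
  -scalerBl => /(congr1 (@cdre _)).
rewrite cdreZ cdreN cdre1 mulr1; have := sqr_ge0 s; nra.
Qed.


(** This is [- a b^(-1)], the solution [J] of [a + J b = 0] for nonzero [b]. *)
Definition fiber_unit (a b : V) : V := - ((cdsqn b)^-1 *: cdmul a (cdconj b)).

Lemma fiber_unit_unique (J a b : V) : b != 0 -> a + cdmul J b = 0 -> J = fiber_unit a b.
Proof.
move=> b0 /eqP; rewrite addr_eq0 => /eqP ->.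
have q0 : cdsqn b != 0 by apply: contraNneq b0 => /cdsqn_eq0 ->.
by rewrite /fiber_unit cdmulNl cdmulVKr scalerN opprK scalerA mulVf ?scale1r.
Qed.

(** The real part of [a b^c] is the scalar product of [a] and [b], and the norm is
    multiplicative. *)
Lemma fiber_unit_imag (a b : V) : b != 0 -> cdsqn a = cdsqn b -> cddot a b = 0 ->
  imag_units (fiber_unit a b).
Proof.
move=> b0 sq dot; have q0 : cdsqn b != 0 by apply: contraNneq b0 => /cdsqn_eq0 ->.
apply/imag_unitsP; rewrite /fiber_unit cdreN cdreZ cdre_mul_conj dot mulr0 oppr0;
  split=> //.
by rewrite cdsqnN cdsqnZ cdsqnM cdsqn_conj sq; field.
Qed.

Lemma fiber_unit_sol (a b : V) : b != 0 -> a + cdmul (fiber_unit a b) b = 0.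
Proof.
move=> b0; have q0 : cdsqn b != 0 by apply: contraNneq b0 => /cdsqn_eq0 ->.
by rewrite /fiber_unit cdmulNl cdmulZl cdmulKr scalerA mulVf ?scale1r ?subrr.
Qed.

(** Here [a = - J b] has the norm of [b], and the scalar product of [J b] and [b] is the real part
    of [(J b) b^c = |b|^2 J], that is 0. *)
Lemma sol_isotropic (J a b : V) : imag_units J -> a + cdmul J b = 0 ->
  cdsqn a = cdsqn b /\ cddot a b = 0.
Proof.
move=> /imag_unitsP[J0 J1] /eqP; rewrite addr_eq0 => /eqP ->.
rewrite cdsqnN cdsqnM J1 mul1r cddotNl -cdre_mul_conj cdmulVKr cdreZ J0 mulr0 oppr0.
by [].
Qed.

Lemma imag_unitsN (J : V) : imag_units J -> imag_units (- J).
Proof. by move=> /imag_unitsP[? ?]; apply/imag_unitsP; rewrite cdreN cdsqnN;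
  split=> //; apply/eqP; rewrite oppr_eq0; apply/eqP. Qed.

Lemma imag_norm (J : V) : imag_units J -> `|J| <= 1.
Proof.
move=> /imag_unitsP[_ J1]; have := norm_le_cdsqn J.
by rewrite J1 expr_le1.
Qed.

Lemma slice_pt_re z (J : V) : imag_units J -> cdre (slice_pt z J) = z.1.
Proof.
by move=> /imag_unitsP[J0 _]; rewrite /slice_pt cdreD !cdreZ cdre1 J0 mulr1 mulr0 addr0.
Qed.

Lemma slice_pt_sqn z (J : V) : imag_units J ->
  cdsqn (slice_pt z J) = z.1 ^+ 2 + z.2 ^+ 2.
Proof.
move=> /imag_unitsP[J0 J1]; rewrite /slice_pt cdsqnD !cdsqnZ cdsqn1 J1 !mulr1.
by rewrite cddotZl cddotZr cddot1 J0 !mulr0 addr0.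
Qed.

(** Real part and norm of a slice point determine [z.1] and [z.2 ^+ 2]. *)
Lemma slice_pt_inj z z' (J J' : V) : imag_units J -> imag_units J' ->
  slice_pt z J = slice_pt z' J' -> z = z' \/ z = cdconj z'.
Proof.
move=> uJ uJ' E; have := slice_pt_re z uJ; rewrite E slice_pt_re // => E1.
have := slice_pt_sqn z uJ; rewrite E slice_pt_sqn // -E1 => /addrI /eqP.
rewrite eqf_sqr => /orP[] /eqP E2; [left|right];
  case: z z' E1 E2 {E} => a b [a' b'] /= -> ->.
  by [].
by rewrite opprK.
Qed.

Lemma circularizationE (D : set (cd R 1)) z (J : V) : conj_invariant D ->
  imag_units J ->
  circularization D (slice_pt z J) <-> D z.
Proof.
move=> cD uJ; split; last by move=> Dz; exists z, J.
move=> [z' [J' [Dz' uJ' /(slice_pt_inj uJ uJ')[->|->]]]] //; exact: cD.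
Qed.

Lemma slice_pt_conj z (J : V) : imag_units J ->
  cdconj (slice_pt z J) = slice_pt z (- J).
Proof.
move=> uJ; rewrite cdconjE slice_pt_re // /slice_pt scalerN.
by rewrite opprD addrA mulr_natl mulr2n scalerDl addrK.
Qed.

End cayley_dickson.

Lemma imag_units_exists (R : realType) (A : algebra_kind) : exists J : alg R A,
  imag_units J.
Proof.
case: A.
- by exists ((0, 1) : cd R 1); apply/(@imag_unitsP R Complexes);
    rewrite /= expr0n expr1n add0r.
- exists (((0, 0), (1, 0)) : cd R 2); apply/(@imag_unitsP R Quaternions).
  by rewrite /= !expr0n expr1n !add0r addr0.
- exists ((((0, 0), (0, 0)), ((1, 0), (0, 0))) : cd R 3);
    apply/(@imag_unitsP R Octonions).
  by rewrite /= !expr0n expr1n !add0r !addr0.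
Qed.

(** The imaginary part has dimension at least 3: either the first imaginary coordinate [b] of [J] is
    0 and the first basis vector serves, or the pair [(b, c)] is rotated by a right angle. *)
Lemma orthogonal_imag (R : realType) (A : algebra_kind) (J : alg R A) : A <>
  Complexes ->
  exists v : alg R A, [/\ v != 0, cdre v = 0 & cddot J v = 0].
Proof.
case: A J => // -[].
- move=> [a b] [c d] _.
  have [b0|b0] := eqVneq b 0.
    exists (((0, 1), (0, 0)) : cd R 2); split => //=; last by rewrite b0; ring.
    by apply/eqP => -[] /eqP; rewrite oner_eq0.
  exists (((0, - c), (b, 0)) : cd R 2); split => //=; last by ring.
  by apply/eqP => -[] _ /eqP; rewrite (negbTE b0).
- move=> [[a b] [c d]] [[e f] [g h]] _.
  have [b0|b0] := eqVneq b 0.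
    exists ((((0, 1), (0, 0)), ((0, 0), (0, 0))) : cd R 3); split => //=;
      last by rewrite b0; ring.
    by apply/eqP => -[] /eqP; rewrite oner_eq0.
  exists ((((0, - c), (b, 0)), ((0, 0), (0, 0))) : cd R 3); split => //=; last by ring.
  by apply/eqP => -[] _ /eqP; rewrite (negbTE b0).
Qed.

(** * Stem functions *)

Section stem_functions.
Variable R : realType.
Local Notation C := (R[i]).
Local Notation e1 := ((1, 0) : cd R 1).
Local Notation e2 := ((0, 1) : cd R 1).

Lemma is_derive_fst (U V W : normedModType R) (F : U -> (V * W)%type) z v d :
  is_derive z v F d -> is_derive z v (fun x => (F x).1) d.1.
Proof.
move=> [h1 h2].
have L : (fun h : R => h^-1 *: (((fun x => (F x).1) \o shift z) (h *: v) - (F z).1))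
  @ 0^' --> d.1.
  have : (fun h : R => h^-1 *: ((F \o shift z) (h *: v) - F z)) @ 0^' --> d
    by rewrite -h2; exact: h1.
  case: d {h2} => d1 d2 K; exact: (cvg_comp _ fst K cvg_fst).
by split; [apply/cvg_ex; exists d.1 | exact/cvg_lim].
Qed.

Lemma is_derive_snd (U V W : normedModType R) (F : U -> (V * W)%type) z v d :
  is_derive z v F d -> is_derive z v (fun x => (F x).2) d.2.
Proof.
move=> [h1 h2].
have L : (fun h : R => h^-1 *: (((fun x => (F x).2) \o shift z) (h *: v) - (F z).2))
  @ 0^' --> d.2.
  have : (fun h : R => h^-1 *: ((F \o shift z) (h *: v) - F z)) @ 0^' --> d
    by rewrite -h2; exact: h1.
  case: d {h2} => d1 d2 K; exact: (cvg_comp _ snd K cvg_snd).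
by split; [apply/cvg_ex; exists d.2 | exact/cvg_lim].
Qed.

(* [dF1 + i dF2] is the complex derivative of the A tensor C valued function
   [F1 + i F2]. *)
Definition stem n (D : set (cd R 1)) (F1 F2 dF1 dF2 : cd R 1 -> cd R n) :=
  forall z, D z ->
    [/\ is_derive z e1 F1 (dF1 z), is_derive z e2 F1 (- dF2 z),
        is_derive z e1 F2 (dF2 z) & is_derive z e2 F2 (dF1 z)] /\
    ({for z, continuous dF1} /\ {for z, continuous dF2}).

Lemma stem_fst n D (F1 F2 dF1 dF2 : cd R 1 -> cd R n.+1) : stem D F1 F2 dF1 dF2 ->
  stem (n := n) D (fun z => (F1 z).1) (fun z => (F2 z).1) (fun z => (dF1 z).1)
    (fun z => (dF2 z).1).
Proof.
move=> h z /h[[a b c d] [p q]]; split; last first.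
  by split; [exact: (cvg_comp _ fst p cvg_fst) | exact: (cvg_comp _ fst q cvg_fst)].
by split; [exact: (is_derive_fst a)|exact: (is_derive_fst b)|exact:
  (is_derive_fst c)|exact: (is_derive_fst d)].
Qed.

Lemma stem_snd n D (F1 F2 dF1 dF2 : cd R 1 -> cd R n.+1) : stem D F1 F2 dF1 dF2 ->
  stem (n := n) D (fun z => (F1 z).2) (fun z => (F2 z).2) (fun z => (dF1 z).2)
    (fun z => (dF2 z).2).
Proof.
move=> h z /h[[a b c d] [p q]]; split; last first.
  by split; [exact: (cvg_comp _ snd p cvg_snd) | exact: (cvg_comp _ snd q cvg_snd)].
by split; [exact: (is_derive_snd a)|exact: (is_derive_snd b)|exact:
  (is_derive_snd c)|exact: (is_derive_snd d)].
Qed.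

Lemma stem_holo D (F1 F2 dF1 dF2 : cd R 1 -> cd R 0) : stem D F1 F2 dF1 dF2 ->
  holo D (fun z => (F1 z : R) +i* (F2 z : R)) (fun z => (dF1 z : R) +i* (dF2 z : R)).
Proof.
move=> h z /h[[a b c d] [p q]]; split; split => //=; exact: cvgN.
Qed.

(* The norm [N(a + i b) = (a + i b)(a^c + i b^c)], that is the sum of the squares
   of the coordinates of [a + i b]. *)
Fixpoint stem_norm n : cd R n -> cd R n -> C :=
  match n with
  | 0 => fun a b : R^o => ((a : R) +i* (b : R)) ^+ 2
  | m.+1 => fun a b : cd R m * cd R m => stem_norm a.1 b.1 + stem_norm a.2 b.2
  end.

Fixpoint stem_norm_deriv n : cd R n -> cd R n -> cd R n -> cd R n -> C :=
  match n with
  | 0 => fun a b da db : R^o =>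
      2 * ((a : R) +i* (b : R)) * ((da : R) +i* (db : R))
  | m.+1 => fun a b da db : cd R m * cd R m =>
      stem_norm_deriv a.1 b.1 da.1 db.1 + stem_norm_deriv a.2 b.2 da.2 db.2
  end.

Lemma stem_normE n (a b : cd R n) : stem_norm a b = (cdsqn a - cdsqn b) +i*
  (2 * cddot a b).
Proof.
elim: n a b => [|n IH] a b /=.
  by rewrite expr2; apply: complex_ext; rewrite /=; ring.
by rewrite !IH; apply: complex_ext; rewrite /=; ring.
Qed.

Lemma stem_norm_eq0 n (a b : cd R n) : stem_norm a b = 0 <-> cdsqn a = cdsqn b /\
  cddot a b = 0.
Proof.
rewrite stem_normE; split => [[/eqP h1 /eqP h2]|[-> ->]]; last by rewrite subrr mulr0.
move: h1 h2; rewrite subr_eq0 => /eqP ->; rewrite mulf_eq0 pnatr_eq0 /= => /eqP ->.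
by [].
Qed.

(** A sum of squares of the holomorphic coordinates [F1_k - y_k + i F2_k], built up along the
    doublings. *)
Lemma stem_norm_holo n D (F1 F2 dF1 dF2 : cd R 1 -> cd R n) y : open D ->
  stem D F1 F2 dF1 dF2 ->
  holo D (fun z => stem_norm (F1 z - y) (F2 z))
    (fun z => stem_norm_deriv (F1 z - y) (F2 z) (dF1 z) (dF2 z)).
Proof.
move=> oD; elim: n F1 F2 dF1 dF2 y => [|n IH] F1 F2 dF1 dF2 y h /=; last first.
  exact: holoD (IH _ _ _ _ y.1 (stem_fst h)) (IH _ _ _ _ y.2 (stem_snd h)).
have h1 := holoD (stem_holo h) (holo_cst (D := D) (- (y : R) +i* 0)).
have := holoM oD h1 h1.
congr holo; apply/funext => z; first by rewrite expr2; apply: complex_ext; rewrite /=;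
  ring.
by apply: complex_ext; rewrite /=; ring.
Qed.

Lemma cvg_fst_snd {T : Type} {F : set_system T} {FF : Filter F}
  (V W : normedModType R) (f : T -> (V * W)%type) (l : (V * W)%type) :
  f @ F --> l <-> (fun x => (f x).1) @ F --> l.1 /\ (fun x => (f x).2) @ F --> l.2.
Proof.
split; last first.
  move=> [p q]; rewrite [l]surjective_pairing.
  have -> : f = (fun z => ((f z).1, (f z).2)) by apply/funext => x; case: (f x).
  exact: (@cvg_pair T V W F (nbhs l.1) (nbhs l.2) _ _ _ (fun z => (f z).1)
    (fun z => (f z).2)).
by case: l => a b h; split; [exact: (cvg_comp _ fst h cvg_fst)|exact:
  (cvg_comp _ snd h cvg_snd)].
Qed.

Lemma stem_continuous n D (F1 F2 dF1 dF2 : cd R 1 -> cd R n) : open D ->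
  stem D F1 F2 dF1 dF2 -> forall z, D z ->
  {for z, continuous F1} /\ {for z, continuous F2}.
Proof.
move=> oD; elim: n F1 F2 dF1 dF2 => [|n IH] F1 F2 dF1 dF2 h z Dz.
  exact: (holo_ccvg oD (stem_holo h) Dz).
have [a b] := IH _ _ _ _ (stem_fst h) z Dz.
have [c d] := IH _ _ _ _ (stem_snd h) z Dz.
by split; apply/cvg_fst_snd; split.
Qed.

(** * Continuity of the algebraic operations *)

Section limits.
Context {T : Type} {F : set_system T} {FF : Filter F}.

Lemma cvg_cdconj n (f : T -> cd R n) l : f @ F --> l ->
  (fun x => cdconj (f x)) @ F --> cdconj l.
Proof.
elim: n f l => [|n IH] f l //= /cvg_fst_snd[p q]; apply/cvg_fst_snd; split => /=.
  exact: IH.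
exact: cvgN.
Qed.

Lemma cvg_cdmul n (f g : T -> cd R n) l m : f @ F --> l -> g @ F --> m ->
  (fun x => cdmul (f x) (g x)) @ F --> cdmul l m.
Proof.
elim: n f g l m => [|n IH] f g l m; first exact: (@cvgM R).
move=> /cvg_fst_snd[p q] /cvg_fst_snd[p' q']; apply/cvg_fst_snd; split => /=.
  by apply: cvgB; apply: IH => //; exact: cvg_cdconj.
by apply: cvgD; apply: IH => //; exact: cvg_cdconj.
Qed.

Lemma cvg_cdsqn n (f : T -> cd R n) l : f @ F --> l ->
  (cdsqn (f x) : R) @[x --> F] --> (cdsqn l : R).
Proof.
elim: n f l => [|n IH] f l; first by move=> h /=; rewrite expr2; exact: cvgM.
by move=> /cvg_fst_snd[p q]; apply: cvgD; exact: IH.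
Qed.

Lemma cvg_cddot n (f g : T -> cd R n) l m : f @ F --> l -> g @ F --> m ->
  (cddot (f x) (g x) : R) @[x --> F] --> (cddot l m : R).
Proof.
elim: n f g l m => [|n IH] f g l m; first exact: (@cvgM R).
move=> /cvg_fst_snd[p q] /cvg_fst_snd[p' q']; apply: cvgD; exact: IH.
Qed.

Lemma cvg_stem_norm n (f g : T -> cd R n) l m : f @ F --> l -> g @ F --> m ->
  ccvg F (fun x => stem_norm (f x) (g x)) (stem_norm l m).
Proof.
move=> p q; rewrite stem_normE; under eq_fun do rewrite stem_normE; split => /=.
  by apply: cvgB; exact: cvg_cdsqn.
by apply: cvgM; [exact: cvg_cst|exact: cvg_cddot].
Qed.

Lemma cvg_fiber_unit A (f g : T -> alg R A) l m : m != 0 -> f @ F --> l ->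
  g @ F --> m ->
  (fun x => fiber_unit (f x) (g x)) @ F --> fiber_unit l m.
Proof.
move=> m0 p q; apply: cvgN; apply: cvgZ.
  by apply: cvgV; [apply: contraNneq m0 => /cdsqn_eq0 ->|exact: cvg_cdsqn].
by apply: cvg_cdmul => //; exact: cvg_cdconj.
Qed.

Lemma cvg_slice_pt n (z : T -> cd R 1) (J : T -> cd R n) z0 J0 : z @ F --> z0 ->
  J @ F --> J0 ->
  (fun x => slice_pt (z x) (J x)) @ F --> slice_pt z0 J0.
Proof.
move=> /cvg_fst_snd[p q] j; apply: cvgD; first exact: cvgZr_tmp.
exact: (@cvgZ R (cd R n) T F _ (fun x => (z x).2)).
Qed.

End limits.

(** Each coordinate [F1_k - y_k + i F2_k] is holomorphic and vanishes at the real points of [D]; as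
    these accumulate at [(a, 0)], the identity theorem applies. *)
Lemma stem_eq_cst n D (F1 F2 dF1 dF2 : cd R 1 -> cd R n) (a : R) y : open D ->
  connected D ->
  D (a, 0) -> stem D F1 F2 dF1 dF2 ->
  (forall s : R, D (s, 0) -> F1 (s, 0) = y /\ F2 (s, 0) = 0) ->
  forall z, D z -> F1 z = y /\ F2 z = 0.
Proof.
move=> oD cD Da; elim: n F1 F2 dF1 dF2 y => [|n IH] F1 F2 dF1 dF2 y h H z Dz;
  last first.
  have [p1 p2] := IH _ _ _ _ y.1 (stem_fst h)
    (fun s Ds => conj (congr1 fst (H s Ds).1) (congr1 fst (H s Ds).2)) z Dz.
  have [q1 q2] := IH _ _ _ _ y.2 (stem_snd h)
    (fun s Ds => conj (congr1 snd (H s Ds).1) (congr1 snd (H s Ds).2)) z Dz.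
  by split; exact: pair_ext.
pose G z : C := (F1 z : R) +i* (F2 z : R) + (- (y : R) +i* 0).
have hG := holoD (stem_holo h) (holo_cst (D := D) (- (y : R) +i* 0)).
suff : G z = 0.
  rewrite /G => -[/eqP p]; rewrite addr0 => q; split => //.
  by move: p; rewrite subr_eq0 => /eqP.
apply: (identity_theorem oD hG cD) => //; exists (a, 0) => //.
have [//|iso] := holo_zero_or_isolated oD hG Da.
exfalso.
have [|d d0 hd] := @nbhs_disc R (a, 0) (D `&` [set w | w != (a, 0) -> G w != 0]).
  by apply: filterI; [exact: open_nbhs_nbhs|exact: iso].
have [|Ds] := hd (d / 2)%:C.
  by rewrite normc_real ger0_norm; lra.
have E : to_plane (of_plane (a, 0) + (d / 2)%:C) = (a + d / 2, 0) by rewrite /to_plane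
  /= addr0.
rewrite E in Ds *; have [F1s F2s] := H _ Ds; move=> /(_ _)/negP; apply.
  by apply/eqP => -[]; lra.
by rewrite /G F1s F2s; apply/eqP; apply: complex_ext; rewrite /= ?subrr ?addr0.
Qed.

End stem_functions.

(** * The open mapping theorem *)

Section slice_functions.
Variables (R : realType) (A : algebra_kind).
Local Notation V := (alg R A).
Variables (D : set (cd R 1)) (F1 F2 dF1 dF2 : cd R 1 -> V) (f : V -> V).
Hypotheses (oD : open D) (cD : conj_invariant D) (st : stem D F1 F2 dF1 dF2).
Hypothesis F2odd : forall z, D z -> F2 (cdconj z) = - F2 z.
Hypothesis fE : forall z J, D z -> imag_units J ->
  f (slice_pt z J) = F1 z + cdmul J (F2 z).

Local Notation Omega := (@circularization R (doublings A) D).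

Let phi (y : V) (z : cd R 1) := stem_norm (F1 z - y) (F2 z).

Lemma fiber_zero z J : D z -> imag_units J -> phi (f (slice_pt z J)) z = 0.
Proof.
move=> Dz uJ; apply/stem_norm_eq0; apply: (sol_isotropic uJ).
by rewrite fE // opprD addrA subrr sub0r addNr.
Qed.

Lemma zero_fiber z y : D z -> phi y z = 0 ->
  exists2 J, imag_units J & f (slice_pt z J) = y.
Proof.
move=> Dz /stem_norm_eq0[sq dot].
have sol J : F1 z - y + cdmul J (F2 z) = 0 -> F1 z + cdmul J (F2 z) = y.
  by rewrite addrAC => /eqP; rewrite subr_eq0 => /eqP.
have [F20|F20] := eqVneq (F2 z) 0.
  (* When [F2 z = 0], isotropy gives [F1 z = y], and [f] equals [y] on the whole sphere over [z]. *)
  have [J uJ] := imag_units_exists R A; exists J => //; rewrite fE //; apply: sol.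
  by rewrite F20 cdmulr0 addr0; apply: cdsqn_eq0; rewrite sq F20 cdsqn0.
exists (fiber_unit (F1 z - y) (F2 z)); first exact: fiber_unit_imag.
by rewrite fE //; [apply: sol; exact: fiber_unit_sol|exact: fiber_unit_imag].
Qed.

Let cvgF1 (y0 : V) z : D z -> (fun p : V * cd R 1 => F1 p.2 - p.1) @ (y0, z) --> F1 z
  - y0.
Proof.
move=> Dz; apply: cvgB; last exact: cvg_fst.
exact: (cvg_comp (fun p : V * cd R 1 => p.2) F1 cvg_snd (stem_continuous oD st Dz).1).
Qed.

Let cvgF2 (y0 : V) z : D z -> (fun p : V * cd R 1 => F2 p.2) @ (y0, z) --> F2 z.
Proof.
move=> Dz.
exact: (cvg_comp (fun p : V * cd R 1 => p.2) F2 cvg_snd (stem_continuous oD st Dz).2).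
Qed.

Lemma near_fiber y0 z0 (W : set (cd R 1)) : D z0 -> phi y0 z0 = 0 ->
  (\forall z \near z0^', phi y0 z != 0) -> nbhs z0 W ->
  \forall y \near y0, exists z, [/\ D z, W z & phi y z = 0].
Proof.
move=> Dz0 p0 iso nW.
have hphi y := stem_norm_holo y oD st.
have cphi z : D z -> ccvg (nbhs (y0, z)) (fun p : V * cd R 1 => phi p.1 p.2) (phi y0 z).
  by move=> Dz; exact: (cvg_stem_norm (@cvgF1 y0 z Dz) (@cvgF2 y0 z Dz)).
exact: (hurwitz oD hphi Dz0 cphi p0 iso nW).
Qed.

Lemma real_point_F2 z : D z -> z.2 = 0 -> F2 z = 0.
Proof.
case: z => a b Dz /= b0; have := F2odd Dz.
have -> : cdconj ((a, b) : cd R 1) = (a, b) by rewrite /= b0 oppr0.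
move=> /eqP; rewrite -addr_eq0 -mulr2n -scaler_nat scaler_eq0 pnatr_eq0 /= => /eqP.
by [].
Qed.

(** A zero of [phi y] near [z0] is realised by a point of the fiber near the given one. If [z0] is
    real, its sphere is a single point and the spheres over nearby [z] lie entirely in [U]. If
    [F2 z0 != 0], the unit is [fiber_unit], which depends continuously on [(y, z)]. *)
Lemma lift_fiber z0 J0 (U : set V) : D z0 -> imag_units J0 ->
  (z0.2 = 0 \/ F2 z0 != 0) -> nbhs (slice_pt z0 J0) U ->
  \forall p \near (f (slice_pt z0 J0), z0), D p.2 -> phi p.1 p.2 = 0 ->
    exists J, [/\ imag_units J, U (slice_pt p.2 J) & f (slice_pt p.2 J) = p.1].
Proof.
move=> Dz0 uJ0 alt nU; set y0 := f _.
have J0E : F1 z0 - y0 + cdmul J0 (F2 z0) = 0.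
  by rewrite /y0 fE // opprD addrA subrr sub0r addNr.
case: alt => [b0|F20].
  have nz : \forall z \near z0, forall J : V, imag_units J -> U (slice_pt z J).
    have [e /= e0 he] := (nbhs_ballP _ _).1 nU.
    (* Imaginary units have norm at most 1, so this constant bounds the displacement of the slice
       point relative to that of [z], uniformly in [J]. *)
    have K : 0 < `|cd1 R (doublings A)| + 1 by rewrite ltr_wpDl.
    apply/nbhs_ballP; exists (e / (`|cd1 R (doublings A)| + 1));
      first by rewrite /= divr_gt0.
    move=> z; rewrite -ball_normE /= distrC => zz0 J uJ; apply: he.
    rewrite -ball_normE /= distrC.
    have -> : slice_pt z J - slice_pt z0 J0 = (z - z0).1 *: cd1 R (doublings A) +
      (z - z0).2 *: J.
      by rewrite /slice_pt b0 scale0r addr0 /= b0 subr0 scalerBl addrAC.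
    apply: le_lt_trans (ler_normD _ _) _; rewrite !normrZ.
    have n1 : `|(z - z0).1| <= `|z - z0| by rewrite [leRHS]/(Order.max _ _) le_max lexx.
    have n2 : `|(z - z0).2| <= `|z - z0| by rewrite [leRHS]/(Order.max _ _) le_max
      lexx orbT.
    have nJ := imag_norm uJ.
    apply: le_lt_trans (_ : `|z - z0| * (`|cd1 R (doublings A)| + 1) < e);
      last by rewrite -ltr_pdivlMr.
    rewrite mulrDr; apply: lerD; first by rewrite ler_wpM2r.
    by apply: ler_pM.
  have nz2 : nbhs (y0, z0) [set p : V * cd R 1 | forall J : V, imag_units J ->
    U (slice_pt p.2 J)].
    exact: (cvg_snd nz).
  apply: filterS nz2 => -[y z] /= Uz Dz p0.
  by have [J uJ fJ] := zero_fiber Dz p0; exists J; split=> //; exact: Uz.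
have K1 : (fun p : V * cd R 1 => slice_pt p.2 (fiber_unit (F1 p.2 - p.1) (F2 p.2)))
  @ (y0, z0) --> slice_pt z0 J0.
  apply: cvg_slice_pt; first exact: cvg_snd.
  rewrite (fiber_unit_unique F20 J0E); apply: cvg_fiber_unit => //;
    [exact: cvgF1|exact: cvgF2].
have K2 := cvg_cdsqn (@cvgF2 y0 z0 Dz0).
have q0 : 0 < cdsqn (F2 z0).
  by rewrite lt_neqAle cdsqn_ge0 andbT eq_sym; apply: contraNneq F20 => /cdsqn_eq0 ->.
have K3 := cvgr_gt _ (K2 _) _ q0.
have K5 : nbhs (y0, z0) [set p : V * cd R 1 | 0 < cdsqn (F2 p.2) /\
    U (slice_pt p.2 (fiber_unit (F1 p.2 - p.1) (F2 p.2)))].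
  by apply: filterI; [exact: K3|exact: (K1 _ nU)].
apply: filterS K5 => -[y z] /= [q U1] Dz /stem_norm_eq0[sq dot].
have F2z : F2 z != 0 by apply: contraTneq q => ->; rewrite cdsqn0 ltxx.
have uJ := fiber_unit_imag F2z sq dot.
exists (fiber_unit (F1 z - y) (F2 z)); split => //.
rewrite fE //; have := fiber_unit_sol (F1 z - y) F2z.
by rewrite addrAC => /eqP; rewrite subr_eq0 => /eqP.
Qed.

(** Hurwitz's theorem supplies, for [y] near the given value, a zero [z] near [z0]; [lift_fiber]
    turns it into a preimage of [y] in [U]. *)
Lemma open_at_nonisolated z0 J0 (U : set V) : D z0 -> imag_units J0 ->
  (z0.2 = 0 \/ F2 z0 != 0) -> (\forall z \near z0^', phi (f (slice_pt z0 J0)) z != 0) ->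
  nbhs (slice_pt z0 J0) U -> nbhs (f (slice_pt z0 J0)) (f @` (Omega `&` U)).
Proof.
move=> Dz0 uJ0 alt iso nU.
have [[P W] /= [nP nW] PW] := lift_fiber Dz0 uJ0 alt nU.
have := near_fiber Dz0 (fiber_zero Dz0 uJ0) iso nW.
apply: filterS2 nP => y Py [z [Dz Wz p0]].
have [J [uJ UJ fJ]] := PW (y, z) (conj Py Wz) Dz p0.
by exists (slice_pt z J) => //; split => //; exists z, J.
Qed.

(** Slice points over numbers with different real parts differ whatever their units are; moving [z0]
    to its conjugate would not guarantee this. *)
Lemma not_isolated_shift (z0 : cd R 1) (P : set (cd R 1)) : nbhs z0 P ->
  exists2 z, P z & z.1 != z0.1.
Proof.
move=> /nbhs_disc[d d0 hd]; exists (to_plane (of_plane z0 + (d / 2)%:C)).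
  by apply: hd; rewrite normc_real ger0_norm; lra.
by rewrite /= -subr_eq0 addrAC subrr add0r; apply: lt0r_neq0; lra.
Qed.

(** Otherwise [phi] vanishes near [z0], and lifting a zero with another real part gives a second
    point of the fiber in the isolating neighbourhood. *)
Lemma discrete_isolated z0 J0 : D z0 -> imag_units J0 ->
  (z0.2 = 0 \/ F2 z0 != 0) ->
  discrete_set (Omega `&` f @^-1` [set f (slice_pt z0 J0)]) ->
  \forall z \near z0^', phi (f (slice_pt z0 J0)) z != 0.
Proof.
move=> Dz0 uJ0 alt disc; set y0 := f _ in disc *.
have [ph0|//] := holo_zero_or_isolated oD (stem_norm_holo y0 oD st) Dz0.
have [|_ [U nU hU]] := disc (slice_pt z0 J0).
  by split => //; exists z0, J0.
have [[P W] /= [nP nW] PW] := lift_fiber Dz0 uJ0 alt nU.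
have nDW : nbhs z0 (D `&` W `&` [set z | phi y0 z = 0]).
  by apply: filterI => //; apply: filterI => //; exact: open_nbhs_nbhs.
have [z [[Dz Wz] p0] zz0] := not_isolated_shift nDW.
have [J [uJ UJ fJ]] := PW (y0, z) (conj (nbhs_singleton nP) Wz) Dz p0.
have : (U `&` (Omega `&` f @^-1` [set y0])) (slice_pt z J).
  by split => //; split => //; exists z, J.
rewrite hU /= => E; exfalso; move/eqP: zz0; apply.
by rewrite -(slice_pt_re z uJ) E slice_pt_re.
Qed.

Lemma nonconstant_isolated y0 z0 : connected D -> (exists a : R, D (a, 0)) ->
  ~ constant_on Omega f -> D z0 -> \forall z \near z0^', phi y0 z != 0.
Proof.
move=> conD [a Da] ncst Dz0.
have hphi := stem_norm_holo y0 oD st.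
have [ph0|//] := holo_zero_or_isolated oD hphi Dz0.
exfalso; apply: ncst; exists y0 => x [z [J [Dz uJ ->]]].
have all0 : forall z, D z -> phi y0 z = 0.
  by apply: (identity_theorem oD hphi conD); exists z0.
have [F1z F2z] : F1 z = y0 /\ F2 z = 0.
  apply: (stem_eq_cst oD conD Da st) Dz => s Ds.
  have F20 := real_point_F2 Ds erefl; split => //.
  have /stem_norm_eq0[] := all0 _ Ds; rewrite F20 cdsqn0 => /cdsqn_eq0/eqP.
  by rewrite subr_eq0 => /eqP.
by rewrite fE // F1z F2z cdmulr0 addr0.
Qed.

(** At [slice_pt z J] the numerator [f x - f x^c] is [2 J F2 z], so a zero of [F2] off the real axis
    is a zero of the spherical derivative. *)
Lemma nonreal_F2_neq0 z J : D z -> imag_units J -> ~ sph_zeros Omega f (slice_pt z J) ->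
  z.2 = 0 \/ F2 z != 0.
Proof.
move=> Dz uJ nz; have [z2|z2] := eqVneq z.2 0; [by left|right].
apply/negP => /eqP F20; apply: nz; split; first by exists z, J.
  move=> [r E]; have [J' uJ'] := imag_units_exists R A.
  have E' : slice_pt z J = slice_pt ((r, 0) : cd R 1) J'.
    by rewrite E /slice_pt /= scale0r addr0.
  by have [] := slice_pt_inj uJ uJ' E' => zE; move: z2; rewrite zE /= ?oppr0 eqxx.
rewrite /spherical_derivative slice_pt_conj // !fE //; last exact: imag_unitsN.
by rewrite F20 !cdmulr0 subrr cdmulr0 scaler0.
Qed.

Lemma open_map_off_sph_zeros : connected D -> (exists a : R, D (a, 0)) ->
  ~ constant_on Omega f -> open_map_on (Omega `\` closure (sph_zeros Omega f)) f.
Proof.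
move=> conD Da ncst U oU; rewrite openE => y [x [[Ox nx] Ux] <-].
case: Ox nx Ux => z [J [Dz uJ ->]] nx Ux.
have alt : z.2 = 0 \/ F2 z != 0.
  by apply: nonreal_F2_neq0 uJ _ => // h; apply: nx; exact: subset_closure.
(* The removed set is closed, so preimages can be sought off it. *)
have nU : nbhs (slice_pt z J) (U `&` ~` closure (sph_zeros Omega f)).
  apply: filterI; apply: open_nbhs_nbhs; split => //.
  by rewrite openC; exact: closed_closure.
apply: filterS (open_at_nonisolated Dz uJ alt (nonconstant_isolated _ conD Da ncst Dz)
  nU).
by apply: image_subset => w [Ow [Uw nw]].
Qed.

(** A circular [U] contains the whole sphere over each zero [w] found by Hurwitz's theorem, so any
    unit furnished by [zero_fiber] will do. *)
Lemma open_image_circular (U : set V) : connected D -> (exists a : R, D (a, 0)) ->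
  ~ constant_on Omega f -> circular U -> open U -> U `<=` Omega -> open (f @` U).
Proof.
move=> conD Da ncst [E [_ cE UE]] oU UO; rewrite openE => y [x Ux <-].
have [z [J [Dz uJ xE]]] := UO _ Ux; rewrite {x}xE in Ux *.
have nW : nbhs z [set w | U (slice_pt w J)].
  have : (fun w : cd R 1 => slice_pt w J) @ z --> slice_pt z J.
    by apply: cvg_slice_pt; [exact: cvg_id|exact: cvg_cst].
  by apply; apply: open_nbhs_nbhs.
have := near_fiber Dz (fiber_zero Dz uJ) (nonconstant_isolated _ conD Da ncst Dz) nW.
apply: filterS => y' [w [Dw Uw p0]].
have [J' uJ' fJ'] := zero_fiber Dw p0.
exists (slice_pt w J') => //; move: Uw; rewrite /= UE => /(circularizationE _ cE uJ) Ew.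
exact/(circularizationE _ cE uJ').
Qed.

(** If [F2 z0 = 0] at a nonreal [z0], then [f] is constant on the sphere over [z0], which contains a
    curve of units through [J0] when [A] is not [C]. *)
Lemma discrete_F2_neq0 z0 J0 : A <> Complexes -> D z0 -> imag_units J0 ->
  discrete_set (Omega `&` f @^-1` [set f (slice_pt z0 J0)]) ->
  z0.2 = 0 \/ F2 z0 != 0.
Proof.
move=> nC Dz0 uJ0 disc; have [z2|z2] := eqVneq z0.2 0; [by left|right].
apply/negP => /eqP F20.
have [|_ [U nU hU]] := disc (slice_pt z0 J0).
  by split => //; exists z0, J0.
have [v [v0 rv dv]] := orthogonal_imag J0 nC.
have [J0re J0sq] := (imag_unitsP J0).1 uJ0.
have q0 : 0 < cdsqn v.
  by rewrite lt_neqAle cdsqn_ge0 andbT eq_sym; apply: contraNneq v0 => /cdsqn_eq0 ->.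
pose den (s : R) := 1 + s ^+ 2 * cdsqn v.
(* Rational parametrisation of a circle of units through [J0], in the plane spanned by [J0] and the
   orthogonal, not normalised, [v]. *)
pose Js (s : R) : V := ((1 - s ^+ 2 * cdsqn v) / den s) *: J0 + (2 * s / den s) *: v.
have den0 s : den s != 0.
  by apply: lt0r_neq0; rewrite /den ltr_pwDl// mulr_ge0 ?sqr_ge0// cdsqn_ge0.
have uJs s : imag_units (Js s).
  apply/imag_unitsP; rewrite /Js cdreD !cdreZ J0re rv !mulr0 addr0; split => //.
  rewrite cdsqnD !cdsqnZ J0sq cddotZl cddotZr dv !mulr0 addr0 mulr1.
  have := den0 s; rewrite /den => d0; by field.
have cs : (fun s : R => s ^+ 2 * cdsqn v) @ (0 : R) --> (0 : R) ^+ 2 * cdsqn v.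
  apply: cvgM; last exact: cvg_cst.
  by rewrite expr2; apply: cvgM; exact: cvg_id.
have cden : den @ (0 : R) --> den 0 by apply: cvgD; [exact: cvg_cst|exact: cs].
have cJ : Js @ (0 : R) --> J0.
  have -> : J0 = Js 0.
    by rewrite /Js /den expr0n /= mul0r subr0 addr0 divr1 scale1r mulr0 mul0r scale0r
      addr0.
  apply: cvgD; apply: cvgZr_tmp; apply: cvgM; try exact: (cvgV (den0 0) cden).
    by apply: cvgB; [exact: cvg_cst|exact: cs].
  by apply: cvgM; [exact: cvg_cst|exact: cvg_id].
have : (fun s : R => slice_pt z0 (Js s)) @ (0 : R) --> slice_pt z0 J0.
  by apply: cvg_slice_pt => //; exact: cvg_cst.
move=> /(_ _ nU) /nbhs_ballP[e /= e0 he].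
have Us : U (slice_pt z0 (Js (e / 2))).
  by apply: he; rewrite -ball_normE /= sub0r normrN ger0_norm; lra.
have : (U `&` (Omega `&` f @^-1` [set f (slice_pt z0 J0)])) (slice_pt z0 (Js (e / 2))).
  by split => //; split; [exists z0, (Js (e / 2))|rewrite /= !fE // F20 !cdmulr0].
(* The scalar product with [v] separates [Js (e / 2)] from [J0]. *)
rewrite hU /= /slice_pt => /addrI /(congr1 (fun x : V => cddot x v)).
rewrite !cddotZl dv mulr0 => /eqP; rewrite mulf_eq0 (negbTE z2) /= /Js.
rewrite cddotDl !cddotZl dv mulr0 add0r cddotxx mulf_eq0 (gt_eqF q0) orbF.
apply/negP; apply: mulf_neq0; last by rewrite invr_eq0; exact: den0.
by apply: lt0r_neq0; rewrite mulr_gt0// divr_gt0.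
Qed.

Lemma open_map_discrete_fibers : A <> Complexes ->
  (forall y0, (f @` Omega) y0 -> discrete_set (Omega `&` f @^-1` [set y0])) ->
  open_map_on Omega f.
Proof.
move=> nC disc U oU; rewrite openE => y [x [Ox Ux] <-].
have dx := disc _ (imageP f Ox).
case: Ox dx Ux => z [J [Dz uJ ->]] dx Ux.
have alt := discrete_F2_neq0 nC Dz uJ dx.
apply: (open_at_nonisolated Dz uJ alt (discrete_isolated Dz uJ alt dx)).
exact: open_nbhs_nbhs.
Qed.

End slice_functions.

(** In [C] the spheres have at most two points, so discrete fibers do not exclude zeros of [F2].
    Instead [Omega] is [D], [f] is itself holomorphic, and zeros of [f - y] are the points of the
    fiber. *)
Lemma open_map_discrete_fibers_complex (R : realType) (D : set (cd R 1))
    (F1 F2 dF1 dF2 f : cd R 1 -> cd R 1) : open D -> conj_invariant D ->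
  stem D F1 F2 dF1 dF2 ->
  (forall z J, D z -> imag_units J -> f (slice_pt z J) = F1 z + cdmul J (F2 z)) ->
  (forall y0, (f @` circularization D) y0 ->
     discrete_set (circularization D `&` f @^-1` [set y0])) ->
  open_map_on (circularization D) f.
Proof.
move=> oD cD st fE disc.
have uI : imag_units ((0, 1) : cd R 1).
  by apply/(@imag_unitsP R Complexes); rewrite /= expr0n expr1n add0r.
have zE (z : cd R 1) : slice_pt z ((0, 1) : cd R 1) = z.
  by case: z => a b; apply: pair_ext; rewrite /= !scaleRo; ring.
have OD : circularization D = D.
  apply/funext => z; apply/propext; rewrite -{1}(zE z).
  exact: (@circularizationE R Complexes D z _ cD uI).
rewrite OD in disc *.
have h1 := stem_holo (stem_fst st); have h2 := stem_holo (stem_snd st).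
have h := holoD h1 (holoM oD (holo_cst (D := D) 'i) h2).
(* The imaginary unit of the stem values is identified with that of [A]; the two holomorphic
   coordinates then combine to [f]. *)
pose psi z := ((F1 z).1 : R) +i* ((F2 z).1 : R) + 'i *
  (((F1 z).2 : R) +i* ((F2 z).2 : R)).
have fpsi z : D z -> f z = to_plane (psi z).
  move=> Dz; rewrite -{1}(zE z) fE // /psi; case: (F1 z) (F2 z) => a b [c d].
  by apply: pair_ext; rewrite /=; ring.
move=> U oU; rewrite openE => y [z [Dz Uz] <-].
have dz := disc _ (imageP f Dz).
pose phi (y : cd R 1) z := psi z + - of_plane y.
have hphi y' : holo D (phi y') _ := holoD h (holo_cst (D := D) (- of_plane y')).
have phi0 y' w : D w -> phi y' w = 0 <-> f w = y'.
  move=> Dw; rewrite fpsi // /phi; split.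
    by move=> /eqP; rewrite subr_eq0 => /eqP ->; rewrite of_planeK.
  by move=> <-; rewrite to_planeK subrr.
have iso : \forall w \near z^', phi (f z) w != 0.
  have [ph0|//] := holo_zero_or_isolated oD (hphi (f z)) Dz.
  have [|_ [W nW hW]] := dz z; first by split.
  have nDW : nbhs z (D `&` W `&` [set w | phi (f z) w = 0]).
    by apply: filterI => //; apply: filterI => //; exact: open_nbhs_nbhs.
  have [w [[Dw Ww] p0] wz] := not_isolated_shift nDW.
  have : (W `&` (D `&` f @^-1` [set f z])) w.
    by split => //; split => //; exact/(phi0 _ _ Dw).
  by rewrite hW /= => E; move: wz; rewrite E eqxx.
have nU : nbhs z U by exact: open_nbhs_nbhs.
have cphi w : D w -> ccvg (nbhs (f z, w)) (fun p : cd R 1 * cd R 1 => phi p.1 p.2)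
  (phi (f z) w).
  move=> Dw; apply: ccvgB.
    exact: (ccvg_comp (cvg_snd : (fun p : cd R 1 * cd R 1 => p.2) @ (f z, w) --> w)
      (holo_ccvg oD h Dw)).
  have c1 : (fun p : cd R 1 * cd R 1 => p.1) @ (f z, w) --> f z by exact: cvg_fst.
  by have [] := (cvg_fst_snd _ _).1 c1.
apply: filterS (hurwitz oD hphi Dz cphi ((phi0 _ _ Dz).2 erefl) iso nU).
by move=> y' [w [Dw Uw /(phi0 _ _ Dw) fw]]; exists w.
Qed.

(** The Cauchy-Riemann equations express the derivatives in beta through those in alpha, which serve
    as [dF1] and [dF2]. *)
Lemma slice_regular_stem (R : realType) n (Omega : set (cd R n)) f :
  slice_regular Omega f -> exists D F1 F2 dF1 dF2,
    [/\ open D, circular_over D Omega, stem D F1 F2 dF1 dF2,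
        forall z, D z -> F2 (cdconj z) = - F2 z &
        forall z J, D z -> imag_units J -> f (slice_pt z J) = F1 z + cdmul J (F2 z)].
Proof.
move=> [D [oD cO [F1 [F2 [[C1 C2] _ F2odd fE CR]]]]].
exists D, F1, F2, (dalpha F1), (dalpha F2); split => //.
case: C1 C2 => a1 b1 c1 _ [a2 b2 c2 _] z Dz; have [E1 E2] := CR z Dz.
rewrite !continuous_open_subspace // in c1 c2; split; last first.
  by split; [apply: c1|apply: c2]; exact: mem_set.
split.
- exact: (derivableP (a1 z Dz)).
- by rewrite -E2; exact: (derivableP (b1 z Dz)).
- exact: (derivableP (a2 z Dz)).
- by rewrite E1; exact: (derivableP (b2 z Dz)).
Qed.

(** Slice regularity and the slice domain condition each come with a planar set; this identifies the
    two. *)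
Lemma circular_over_unique (R : realType) (A : algebra_kind) (D E : set (cd R 1))
    (Omega : set (alg R A)) : circular_over D Omega -> circular_over E Omega -> D = E.
Proof.
move=> [_ cD OD] [_ cE OE]; have [J uJ] := imag_units_exists R A.
apply/seteqP; split => z h.
  by apply/(circularizationE _ cE uJ); rewrite -OE OD; apply/circularizationE.
by apply/(circularizationE _ cD uJ); rewrite -OD OE; apply/circularizationE.
Qed.

Theorem theorem5p7 (R : realType) (A : algebra_kind) (Omega : set (alg R A))
    (f : alg R A -> alg R A)
    (hcirc : circular Omega) (hopen : open Omega)
    (hf : slice_regular Omega f) :
  (slice_domain Omega -> ~ constant_on Omega f ->
    [/\ open_map_on (Omega `\` closure (sph_zeros Omega f)) f,
        forall U : set (alg R A), circular U -> open U -> U `<=` Omega ->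
          open (f @` U) &
        open (f @` Omega)]) /\
  ((forall y0, (f @` Omega) y0 -> discrete_set (Omega `&` f @^-1` [set y0])) ->
    open_map_on Omega f).
Proof.
have [D [F1 [F2 [dF1 [dF2 [oD cO st F2odd fE]]]]]] := slice_regular_stem hf.
have [_ cD OD] := cO; split.
  move=> [D' [cO' _ conD Da]] ncst.
  rewrite -(circular_over_unique cO cO') in conD Da.
  have img := open_image_circular oD st F2odd fE conD Da.
  subst Omega; split.
  - exact: (open_map_off_sph_zeros oD st F2odd fE conD Da).
  - by move=> U; exact: img.
  - exact: img.
subst Omega => disc.
case: A f hcirc hopen hf F1 F2 dF1 dF2 st F2odd fE disc {cO} => f hcirc hopen hf F1 F2
  dF1 dF2 st F2odd fE disc.
- exact: (@open_map_discrete_fibers_complex R D F1 F2 dF1 dF2).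
- exact: (@open_map_discrete_fibers R Quaternions D F1 F2 dF1 dF2).
- exact: (@open_map_discrete_fibers R Octonions D F1 F2 dF1 dF2).
Qed.
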